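(* Let $0<\alpha\le1$. Let $\mathcal{J}\subset\mathbb{R}^2$ be a self-similar set satisfying the Open Set Condition, with Hausdorff dimension $\dim(\mathcal{J})=\alpha$, and not contained in a line. Write $\mathcal{J}^\delta$ for the $\delta$-neighbourhood of $\mathcal{J}$. (a) If $\alpha=1$, then there are $C_0$ and $\kappa>0$ depending only on $\mathcal{J}$ such that for every $0<\delta\le 1$, $\mathcal{J}^\delta$ is equivalent to a $(\kappa,C_0,\delta)$-unrectifiable one-set. (b) If $0<\alpha<1$, then there is $C_0$ depending only on $\mathcal{J}$ such that for every $0<\delta\le1$, $\mathcal{J}^\delta$ is equivalent to an $(\alpha,C_0,\delta)$-set that is unconcentrated on lines. (c) If $0<\alpha<1$ and $\varphi:\mathbb{R}^2\to\mathbb{R}^2$ is a diffeomorphism, then there is $C_0$ depending only on $\mathcal{J}$ and $\varphi$ such that for every $0<\delta\le1$, $\varphi(\mathcal{J}^\delta)$ is equivalent to an $(\alpha,C_0,\delta)$-set that is unconcentrated on lines.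
   Context: A self-similar set is a non-empty compact $\mathcal{J}\subset\mathbb{R}^2$ with $\mathcal{J}=\bigcup_{i=1}^sT_i(\mathcal{J})$, where $T_i(x)=\lambda_i\mathcal{O}_ix+z_i$, $0<\lambda_i<1$, $\mathcal{O}_i$ orthogonal. Open Set Condition: there is a (non-empty) open set $O\subset\mathbb{R}^2$ with $\bigcup_iT_i(O)\subset O$ and the $T_i(O)$ pairwise disjoint. For a set $S$, $S^\rho=\bigcup_{x\in S}B(x,\rho)$ with $B(x,\rho)$ the closed ball. $|\cdot|$ is Lebesgue measure. Let $\delta>0$, $0<\alpha\le1$, $C>0$. A set $\mathcal{A}\subset\mathbb{R}^2$ is an $(\alpha,C,\delta)$-set that is unconcentrated on lines if: (i) $\mathcal{A}$ is a non-empty union of closed balls of radius $\delta$ with at most $C$-fold overlap (every $x\in\mathbb{R}^2$ belongs to at most $C$ of the balls); (ii) $C^{-1}\delta^{2-\alpha}\le|\mathcal{A}|\le C\delta^{2-\alpha}$; (iii) for every ball $B$ of radius $r$, $|\mathcal{A}\cap B|\le Cr^\alpha|\mathcal{A}|$; (iv) for every line $\ell$, $|\mathcal{A}\cap\ell^{1/C}|\le|\mathcal{A}|/10$. For $0<\kappa\le\frac12$, $\mathcal{A}$ is a $(\kappa,C,\delta)$-unrectifiable one-set if it is a $(1,C,\delta)$-set that is unconcentrated on lines and for every rectangle $R$ (of any orientation) with side lengths $r_1\le r_2$, $|\mathcal{A}\cap R|\le Cr_1^{\kappa}r_2^{1-\kappa}|\mathcal{A}|$. A set $\mathcal{A}$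 is equivalent to an $(\alpha,C,\delta)$-set that is unconcentrated on lines if there are $(\alpha,C_i,\delta_i)$-sets $\mathcal{A}_1,\mathcal{A}_2$ that are unconcentrated on lines, with $C_i\sim C$ and $\delta_i\sim\delta$ $(i=1,2)$, such that $\mathcal{A}_1\subset\mathcal{A}\subset\mathcal{A}_2$; here $\sim$ means comparable up to multiplicative constants independent of $\delta$ (in this statement depending only on $\mathcal{J}$, and in (c) also on $\varphi$). Equivalence to a $(\kappa,C,\delta)$-unrectifiable one-set is defined analogously, with $\mathcal{A}_i$ being $(\kappa,C_i,\delta_i)$-unrectifiable one-sets. *)

(* Defs.v *)
From HB Require Import structures.
From mathcomp Require Import all_boot all_order all_algebra.
From mathcomp Require Import all_classical all_reals all_analysis.

Set Implicit Arguments.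
Unset Strict Implicit.
Unset Printing Implicit Defensive.
Import Order.TTheory GRing.Theory Num.Theory.
Import numFieldNormedType.Exports.
Local Open Scope classical_set_scope.
Local Open Scope ring_scope.

(* The plane is [R * R]; its library topology is the usual one, but its library
   norm is the sup norm, so Euclidean distances and balls are introduced here. *)
Notation plane R := (R * R)%type.

Section Plane.
Variable R : realType.
Implicit Types (x y p u v : plane R) (A S J O : set (plane R)).

Definition dot x y : R := x.1 * y.1 + x.2 * y.2.

Definition eucl_dist x y : R := Num.sqrt (dot (x - y) (x - y)).

Definition disc x (r : R) : set (plane R) := [set y | eucl_dist x y <= r].

Definition thicken S (r : R) : set (plane R) := \bigcup_(x in S) disc x r.

Definition area : set (plane R) -> \bar R :=
  (@lebesgue_measure R \x @lebesgue_measure R)%E.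

Definition is_line (l : set (plane R)) : Prop :=
  exists p v, v != 0 /\ l = [set p + t *: v | t in [set: R]].

Definition is_rectangle (r1 r2 : R) (Q : set (plane R)) : Prop :=
  exists p u v, [/\ dot u u = 1, dot v v = 1, dot u v = 0 &
    Q = [set p + a.1 *: u + a.2 *: v | a in `[0, r1] `*` `[0, r2]]].

Definition mx_apply (M : 'M[R]_2) x : plane R :=
  (M 0 0 * x.1 + M 0 1 * x.2, M 1 0 * x.1 + M 1 1 * x.2).

Definition orthogonal_mx (M : 'M[R]_2) : Prop := M *m M^T = 1%:M.

Record similitude := Similitude {
  sim_ratio : R;
  sim_mx : 'M[R]_2;
  sim_shift : plane R;
  sim_ratioP : 0 < sim_ratio < 1;
  sim_mxP : orthogonal_mx sim_mx }.

Definition sim_apply (T : similitude) x : plane R :=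
  sim_ratio T *: mx_apply (sim_mx T) x + sim_shift T.

Definition self_similar (s : nat) (T : 'I_s -> similitude) J : Prop :=
  [/\ J !=set0, compact J & J = \bigcup_i (sim_apply (T i) @` J)].

Definition open_set_condition (s : nat) (T : 'I_s -> similitude) : Prop :=
  exists O, [/\ O !=set0, open O,
    \bigcup_i (sim_apply (T i) @` O) `<=` O &
    trivIset [set: 'I_s] (fun i => sim_apply (T i) @` O)].

Definition self_similar_OSC J : Prop :=
  exists s (T : 'I_s -> similitude), self_similar T J /\ open_set_condition T.

(* The element 0 makes the diameter of the empty set equal to 0. *)
Definition ediam A : \bar R :=
  ereal_sup (0%E |` [set (eucl_dist p.1 p.2)%:E | p in A `*` A]).

Definition hausdorff_premeasure (s d : R) A : \bar R :=
  ereal_inf [set (\sum_(0 <= i <oo) poweR (ediam (U i)) s)%E |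
    U in [set U : nat -> set (plane R) |
      A `<=` \bigcup_i U i /\ forall i, (ediam (U i) <= d%:E)%E]].

Definition hausdorff_measure (s : R) A : \bar R :=
  ereal_sup [set hausdorff_premeasure s d A | d in [set d | 0 < d]].

(* Restricting to [0 < s] does not change the infimum over [0 <= s] and avoids
   choosing a value for 0 ^ 0. *)
Definition hausdorff_dim A : \bar R :=
  ereal_inf [set s%:E | s in [set s | 0 < s /\ hausdorff_measure s A = 0%E]].

(* The union is indexed by the set of centres of the balls. *)
Definition disc_union (C delta : R) A : Prop :=
  exists S, [/\ S !=set0, A = thicken S delta &
    forall x, exists2 n : nat, n%:R <= C &
      ([set c | S c /\ disc c delta x] #<= `I_n)%card].

(* All sets measured below are measurable: bounded overlap makes the family of
   discs locally finite. *)
Definition unconcentrated_set (alpha C delta : R) A : Prop :=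
  [/\ [/\ 0 < delta, 0 < alpha <= 1 & 0 < C],
      disc_union C delta A,
      ((C^-1 * delta `^ (2 - alpha))%:E <= area A)%E /\
        (area A <= (C * delta `^ (2 - alpha))%:E)%E,
      forall x (r : R), 0 < r ->
        (area (A `&` disc x r) <= (C * r `^ alpha)%:E * area A)%E &
      forall l, is_line l ->
        (area (A `&` thicken l C^-1) <= (10^-1)%:E * area A)%E].

Definition unrectifiable_one_set (kappa C delta : R) A : Prop :=
  [/\ 0 < kappa <= 2^-1,
      unconcentrated_set 1 C delta A &
      forall (r1 r2 : R) Q, 0 < r1 -> r1 <= r2 -> is_rectangle r1 r2 Q ->
        (area (A `&` Q) <=
           (C * r1 `^ kappa * r2 `^ (1 - kappa))%:E * area A)%E].

Definition comparable_up_to (K a b : R) : Prop := K^-1 * b <= a <= K * b.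

(* [K] is the implied constant in the relations C_i ~ C and delta_i ~ delta. It
   is a parameter so that it can be quantified before [delta]. *)
Definition equivalent_to (P : R -> R -> set (plane R) -> Prop)
    (K C delta : R) A : Prop :=
  exists C1 C2 delta1 delta2 A1 A2,
    [/\ comparable_up_to K C1 C /\ comparable_up_to K C2 C,
        comparable_up_to K delta1 delta /\ comparable_up_to K delta2 delta,
        P C1 delta1 A1, P C2 delta2 A2 & A1 `<=` A /\ A `<=` A2].

Definition C1_map (f : plane R -> plane R) : Prop :=
  (forall x, differentiable f x) /\
  (forall v, continuous (fun x => 'd f x v)).

Definition diffeomorphism (f : plane R -> plane R) : Prop :=
  exists g, [/\ cancel f g, cancel g f, C1_map f & C1_map g].

End Plane.

(* Main.v *)
(* Let lam_w be the contraction ratio of T_w for a word w over the maps T_i, let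
   D be the solution of sum_i lam_i^D = 1, and let W_r be the set of words w
   with lam_w <= r no proper prefix of which has this property.  The weights lam_w^D of
   the words of W_r add up to 1 and are all comparable to r^D, and W_r refines
   W_r' for r <= r': its words are the concatenations u v with u in W_r' and v
   in W_(r / lam_u).  If the open set of the Open Set Condition contains a ball
   around o, the points T_w o (w in W_r) are separated by a multiple of r, so
   that a ball of radius t >= r has mass O(t^D).  This mass distribution gives
   dim J = D, whence D = alpha.

   Since J is not contained in a line, every line misses a whole cylinder at some
   fixed scale; iterating this inside the other cylinders, the t-neighbourhood
   of any line has mass O(t^k) for some k > 0, and a t x q rectangle has mass
   O(t^k q^(D - k)).  A diffeomorphism is nearly affine on small cylinders,
   hence the neighbourhoods of preimages of lines also have small mass.

   J^delta is squeezed between two unions of discs of radius comparable to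
   delta, centred at the points T_w o, w in W_r, with r comparable to delta;
   for these the masses translate directly into areas. *)

Require Import Defs.
From HB Require Import structures.
From mathcomp Require Import all_boot all_order all_algebra.
From mathcomp Require Import all_classical all_reals all_analysis.
From mathcomp Require Import measurable_realfun ring lra.

Set Implicit Arguments.
Unset Strict Implicit.
Unset Printing Implicit Defensive.
Import Order.TTheory GRing.Theory Num.Theory.
Import numFieldNormedType.Exports.
Local Open Scope classical_set_scope.
Local Open Scope ring_scope.

(** * Euclidean geometry of the plane *)

(** No limit measure on J is constructed. The finite weights of one level r act as a measure on sets
    of size at least r; this is the source of the hypotheses [r <= t] in the mass estimates, and
    below that size direct area bounds take over. The Open Set Condition gives a point o of the open
    set, but not one that also lies on J. The centres T_w o may therefore lie off J; they stay
    within a multiple of r of it, which only costs constants. In the line condition the same C sets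
    the width of the strip, while the factor 1/10 is fixed. The gain is therefore made at one scale:
    a diffeomorphism has to be flat only on the cylinders of one fixed level d, and for the
    remaining coarse values of r a large C makes the strip itself thin enough. The factor K in the
    radius K r is left free, because the inner and the outer union of discs have the same centres
    and different radii. Parts (a) and (b) are the case of the identity map. *)

Section Euclid.
Variable R : realType.
Implicit Types (x y z p u v : plane R) (a r : R).

Definition enorm x : R := Num.sqrt (dot x x).

Lemma eucl_distE x y : eucl_dist x y = enorm (x - y). Proof. by []. Qed.

Lemma scale1E a x : (a *: x).1 = a * x.1. Proof. by []. Qed.
Lemma scale2E a x : (a *: x).2 = a * x.2. Proof. by []. Qed.
Lemma add1E x y : (x + y).1 = x.1 + y.1. Proof. by []. Qed.
Lemma add2E x y : (x + y).2 = x.2 + y.2. Proof. by []. Qed.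
Lemma opp1E x : (- x).1 = - x.1. Proof. by []. Qed.
Lemma opp2E x : (- x).2 = - x.2. Proof. by []. Qed.
Definition planeE := (scale1E, scale2E, add1E, add2E, opp1E, opp2E).

Lemma plane_ext x y : x.1 = y.1 -> x.2 = y.2 -> x = y.
Proof. by case: x y => [? ?] [? ?] /= -> ->. Qed.

Lemma dot_ge0 x : 0 <= dot x x.
Proof. by rewrite addr_ge0 // -expr2 sqr_ge0. Qed.

Lemma enorm_ge0 x : 0 <= enorm x. Proof. exact: sqrtr_ge0. Qed.

Lemma enorm_sqr x : enorm x ^+ 2 = dot x x.
Proof. by rewrite sqr_sqrtr // dot_ge0. Qed.

Lemma enorm_le x a : 0 <= a -> (enorm x <= a) = (dot x x <= a ^+ 2).
Proof.
by move=> a0; rewrite -enorm_sqr ler_sqr // nnegrE ?enorm_ge0.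
Qed.

Lemma enorm0 : enorm 0 = 0.
Proof. by rewrite /enorm /dot !mulr0 addr0 sqrtr0. Qed.

Lemma enorm0_eq0 x : enorm x = 0 -> x = 0.
Proof.
move=> h; have := enorm_sqr x; rewrite h expr0n /= /dot => h2.
have h1 : x.1 ^+ 2 = 0 by nra.
have h3 : x.2 ^+ 2 = 0 by nra.
by apply: plane_ext; apply/eqP; rewrite -sqrf_eq0; apply/eqP.
Qed.

Lemma enorm_gt0 x : x != 0 -> 0 < enorm x.
Proof.
by move=> x0; rewrite lt0r enorm_ge0 andbT; apply: contra_neq x0 => /enorm0_eq0.
Qed.

Lemma enormN x : enorm (- x) = enorm x.
Proof. by rewrite /enorm /dot !planeE !mulrNN. Qed.

Lemma enormB x y : enorm (x - y) = enorm (y - x).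
Proof. by rewrite -enormN opprB. Qed.

Lemma enormZ a x : enorm (a *: x) = `|a| * enorm x.
Proof.
rewrite /enorm -sqrtr_sqr -sqrtrM ?sqr_ge0 //; congr Num.sqrt.
by rewrite /dot !planeE; ring.
Qed.

(** Lagrange's identity: the defect in the squared Cauchy-Schwarz inequality is the square of the
    determinant of [x] and [y]. *)
Lemma dot_le x y : dot x y <= enorm x * enorm y.
Proof.
have [d0|d0] := leP (dot x y) 0.
  by apply: le_trans d0 _; rewrite mulr_ge0 ?enorm_ge0.
rewrite -ler_sqr ?nnegrE ?mulr_ge0 ?enorm_ge0 // ?(ltW d0) //.
rewrite exprMn !enorm_sqr -subr_ge0.
have -> : dot x x * dot y y - dot x y ^+ 2 = (x.1 * y.2 - x.2 * y.1) ^+ 2.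
  by rewrite /dot; ring.
exact: sqr_ge0.
Qed.

Lemma enormD x y : enorm (x + y) <= enorm x + enorm y.
Proof.
rewrite enorm_le ?addr_ge0 ?enorm_ge0 //.
have -> : dot (x + y) (x + y) = dot x x + dot x y *+ 2 + dot y y.
  by rewrite /dot !planeE; ring.
rewrite sqrrD !enorm_sqr lerD2r lerD2l.
by rewrite lerMn2r /=; exact: dot_le.
Qed.

Lemma enorm_triangle z x y : enorm (x - y) <= enorm (x - z) + enorm (z - y).
Proof. by apply: le_trans (enormD _ _); rewrite addrA subrK. Qed.

Lemma norm1_le_enorm x : `|x.1| <= enorm x.
Proof.
rewrite -ler_sqr ?nnegrE ?enorm_ge0 // enorm_sqr real_normK ?num_real //.
by rewrite /dot; nra.
Qed.

Lemma norm2_le_enorm x : `|x.2| <= enorm x.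
Proof.
rewrite -ler_sqr ?nnegrE ?enorm_ge0 // enorm_sqr real_normK ?num_real //.
by rewrite /dot; nra.
Qed.

Lemma enorm_le_sum x : enorm x <= `|x.1| + `|x.2|.
Proof.
rewrite enorm_le ?addr_ge0 // sqrrD !real_normK ?num_real // /dot.
have := mulr_ge0 (normr_ge0 x.1) (normr_ge0 x.2); nra.
Qed.

Lemma enorm_le_max x r : `|x.1| <= r -> `|x.2| <= r -> enorm x <= 2 * r.
Proof. by move=> h1 h2; apply: le_trans (enorm_le_sum x) _; lra. Qed.

Lemma discE x r y : disc x r y = (enorm (x - y) <= r). Proof. by []. Qed.

Lemma disc_refl x r : 0 <= r -> disc x r x.
Proof. by move=> r0; rewrite discE subrr enorm0. Qed.

Lemma thickenP (A : set (plane R)) r x :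
  thicken A r x <-> exists2 y, A y & enorm (y - x) <= r.
Proof. by split => -[y Ay yx]; exists y. Qed.

(** The determinant; divided by [enorm v], its absolute value at [x - p] is the distance from [x] to
    the line through [p] with direction [v]. *)
Definition cross x y : R := x.1 * y.2 - x.2 * y.1.

Lemma cross_le x y : `|cross x y| <= enorm x * enorm y.
Proof.
rewrite -ler_sqr ?nnegrE ?mulr_ge0 ?enorm_ge0 // real_normK ?num_real //.
rewrite exprMn !enorm_sqr -subr_ge0.
have -> : dot x x * dot y y - cross x y ^+ 2 = dot x y ^+ 2.
  by rewrite /dot /cross; ring.
exact: sqr_ge0.
Qed.

Lemma thicken_line p v r x : v != 0 ->
  thicken [set p + t *: v | t in [set: R]] r x <->
  `|cross (x - p) v| <= r * enorm v.
Proof.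
move=> v0; have nv := enorm_gt0 v0; have dv : 0 < dot v v.
  by rewrite -enorm_sqr exprn_gt0.
rewrite thickenP; split.
  move=> [_ [t _ <-] h].
  have -> : cross (x - p) v = - cross (p + t *: v - x) v.
    by rewrite /cross !planeE; ring.
  by rewrite normrN; apply: le_trans (cross_le _ _) _; rewrite ler_pM2r.
(* The foot of the perpendicular from [x]. *)
move=> h; exists (p + (dot (x - p) v / dot v v) *: v); first by exists (dot (x - p) v / dot v v).
rewrite -(ler_pM2r nv).
apply: le_trans h.
rewrite -ler_sqr ?nnegrE ?mulr_ge0 ?enorm_ge0 // real_normK ?num_real //.
rewrite exprMn !enorm_sqr.
have h0 : dot v v != 0 by rewrite gt_eqF.
rewrite le_eqVlt; apply/orP; left; apply/eqP; rewrite /dot /cross !planeE; field.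
by rewrite /dot in h0.
Qed.

(** Allowing [v = 0] makes this applicable to the image of a line under a differential without
    discussing its rank. *)
Lemma line_through p v : exists2 l, is_line l & forall t, l (p + t *: v).
Proof.
have [->|v0] := eqVneq v 0.
  exists [set p + t *: ((1, 0) : plane R) | t in [set: R]].
    exists p, (1, 0); split => //; apply/eqP => -[/eqP]; by rewrite oner_eq0.
  by move=> t; exists 0 => //; rewrite scaler0 scale0r.
by exists [set p + t *: v | t in [set: R]]; [exists p, v | move=> t; exists t].
Qed.

End Euclid.

(** * Areas *)

Section Area.
Variable R : realType.
Implicit Types (x y p u v : plane R) (A B E : set (plane R)) (a r : R).
Local Notation MR := (measurableTypeR R).

(** The cast selects the product of the Borel sigma-algebras, on which [area] is a measure. *)
Definition bmeas A : Prop := measurable (A : set (MR * MR)).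

Lemma area_le A B : bmeas A -> bmeas B -> A `<=` B -> (area A <= area B)%E.
Proof. by move=> mA mB AB; apply: le_measure => //; rewrite inE. Qed.

Lemma area0 : area (set0 : set (plane R)) = 0%E. Proof. exact: measure0. Qed.

Lemma areaU A B : bmeas A -> bmeas B -> A `&` B = set0 ->
  area (A `|` B) = (area A + area B)%E.
Proof. by move=> mA mB AB; exact: measureU. Qed.

Lemma areaU_le A B : bmeas A -> bmeas B ->
  (area (A `|` B) <= area A + area B)%E.
Proof. by move=> mA mB; exact: measureU2. Qed.

Lemma bmeas0 : bmeas set0. Proof. exact: measurable0. Qed.
Lemma bmeasU A B : bmeas A -> bmeas B -> bmeas (A `|` B).
Proof. exact: measurableU. Qed.
Lemma bmeasI A B : bmeas A -> bmeas B -> bmeas (A `&` B).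
Proof. exact: measurableI. Qed.

Definition box (a b c d : R) : set (plane R) := `[a, b] `*` `[c, d].

Lemma bmeas_box a b c d : bmeas (box a b c d).
Proof. by apply: measurableX. Qed.

Lemma area_box a b c d : a <= b -> c <= d ->
  area (box a b c d) = ((b - a) * (d - c))%:E.
Proof.
move=> ab cd; rewrite /area product_measure1E //=.
rewrite !lebesgue_measure_itv /= !lte_fin.
have h (p q : R) : p <= q -> (if p < q then (q%:E - p%:E)%E else 0%E) = (q - p)%:E.
  by rewrite le_eqVlt => /orP[/eqP ->|->//]; rewrite ltxx subrr.
by rewrite !h.
Qed.

Definition bfun (f : plane R -> R) : Prop :=
  measurable_fun [set: MR * MR] (f : MR * MR -> MR).

Lemma bfun1 : bfun (fun x => x.1). Proof. exact: measurable_fst. Qed.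
Lemma bfun2 : bfun (fun x => x.2). Proof. exact: measurable_snd. Qed.
Lemma bfun_cst a : bfun (fun=> a). Proof. exact: measurable_cst. Qed.
Lemma bfunD f g : bfun f -> bfun g -> bfun (fun x => f x + g x).
Proof. exact: measurable_funD. Qed.
Lemma bfunM f g : bfun f -> bfun g -> bfun (fun x => f x * g x).
Proof. exact: measurable_funM. Qed.
Lemma bfunB f g : bfun f -> bfun g -> bfun (fun x => f x - g x).
Proof. exact: measurable_funB. Qed.

Lemma bmeas_le f g : bfun f -> bfun g -> bmeas [set x | f x <= g x].
Proof.
move=> mf mg; have := measurable_fun_ler mf mg => /(_ measurableT [set true]).
rewrite setTI; exact.
Qed.

Lemma bmeas_disc x r : bmeas (disc x r).
Proof.
have [r0|r0] := leP 0 r; last first.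
  rewrite (_ : disc x r = set0); first exact: bmeas0.
  apply/seteqP; split => y //=; rewrite discE leNgt => /negP; apply.
  exact: lt_le_trans r0 (enorm_ge0 _).
rewrite (_ : disc x r = [set y | (x.1 - y.1) * (x.1 - y.1) +
  (x.2 - y.2) * (x.2 - y.2) <= r ^+ 2]).
  apply: bmeas_le; last exact: bfun_cst.
  by apply: bfunD; apply: bfunM; apply: bfunB;
    (exact: bfun_cst || exact: bfun1 || exact: bfun2).
by apply/seteqP; split => y; rewrite /= discE enorm_le.
Qed.

Lemma bmeas_thicken_line l r : is_line l -> bmeas (thicken l r).
Proof.
move=> [p [v [v0 ->]]].
rewrite (_ : thicken _ r = [set x | cross (x - p) v <= r * enorm v] `&`
  [set x | - (r * enorm v) <= cross (x - p) v]); last first.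
  apply/seteqP; split => x /=; first by move/(thicken_line _ _ _ v0); rewrite ler_norml => /andP[].
  by move=> [h1 h2]; apply/(thicken_line _ _ _ v0); rewrite ler_norml h2.
have h : bfun (fun x => cross (x - p) v).
  by apply: bfunB; apply: bfunM; rewrite ?planeE; try exact: bfun_cst; apply: bfunB;
    (exact: bfun_cst || exact: bfun1 || exact: bfun2).
by apply: bmeasI; apply: bmeas_le => //; exact: bfun_cst.
Qed.

(** Coordinates in an orthonormal frame turn the image of a box into four linear inequalities, from
    which measurability and inclusions can be read off. *)
Lemma rectangleE p u v r1 r2 :
  dot u u = 1 -> dot v v = 1 -> dot u v = 0 ->
  [set p + a.1 *: u + a.2 *: v | a in `[0, r1] `*` `[0, r2]] =
  [set x | [/\ 0 <= dot (x - p) u, dot (x - p) u <= r1,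
     0 <= dot (x - p) v & dot (x - p) v <= r2]].
Proof.
move=> uu vv uv; apply/seteqP; split => x /=.
  move=> [[a b] /= [/=]]; rewrite !in_itv /= => /andP[a0 a1] /andP[b0 b1] <-.
  have -> : dot (p + a *: u + b *: v - p) u = a.
    transitivity (a * dot u u + b * dot u v); last by rewrite uu uv; ring.
    by rewrite /dot !planeE; ring.
  have -> : dot (p + a *: u + b *: v - p) v = b.
    transitivity (a * dot u v + b * dot v v); last by rewrite vv uv; ring.
    by rewrite /dot !planeE; ring.
  by split.
move=> [a0 a1 b0 b1]; exists (dot (x - p) u, dot (x - p) v).
  by split => /=; rewrite in_itv /= ?a0 ?a1 ?b0 ?b1.
(* The rows u, v of a 2 x 2 matrix are orthonormal, hence so are its columns. *)
have [e1 [e2 e3]] : u.1 ^+ 2 + v.1 ^+ 2 = 1 /\ u.2 ^+ 2 + v.2 ^+ 2 = 1 /\ u.1 * u.2 + v.1 * v.2 = 0.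
  have h : (\matrix_(i < 2, j < 2) (if i == 0 then (if j == 0 then u.1 else u.2)
     else (if j == 0 then v.1 else v.2)) : 'M[R]_2) *m
     (\matrix_(i < 2, j < 2) (if j == 0 then (if i == 0 then u.1 else u.2)
     else (if i == 0 then v.1 else v.2)) : 'M[R]_2) = 1%:M.
    apply/matrixP => i j; rewrite !mxE big_ord_recl big_ord1 !mxE /=.
    move: uu vv uv; rewrite /dot.
    case: i => -[|[|//]] ? ; case: j => -[|[|//]] ? /=; nra.
  move/mulmx1C: h => /matrixP h.
  have := h 0 0; have := h 1 1; have := h 0 1.
  rewrite !mxE !big_ord_recl !big_ord0 !mxE /= => h1 h2 h3.
  by move: h1 h2 h3; rewrite ?mulr1n ?mulr0n => h1 h2 h3; split; [|split]; nra.
apply: plane_ext; rewrite !planeE /= /dot !planeE.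
  transitivity (p.1 + (x.1 - p.1) * (u.1 ^+ 2 + v.1 ^+ 2) + (x.2 - p.2) * (u.1 * u.2 + v.1 * v.2)).
    ring.
  by rewrite e1 e3; ring.
transitivity (p.2 + (x.2 - p.2) * (u.2 ^+ 2 + v.2 ^+ 2) + (x.1 - p.1) * (u.1 * u.2 + v.1 * v.2)).
  ring.
by rewrite e2 e3; ring.
Qed.

Lemma bfun_dot p v : bfun (fun x => dot (x - p) v).
Proof.
by apply: bfunD; apply: bfunM; rewrite ?planeE; try exact: bfun_cst; apply: bfunB;
    (exact: bfun_cst || exact: bfun1 || exact: bfun2).
Qed.

Lemma bmeas_rectangle r1 r2 Q : is_rectangle r1 r2 Q -> bmeas Q.
Proof.
move=> [p [u [v [uu vv uv ->]]]]; rewrite rectangleE //.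
rewrite (_ : [set x | _] = ([set x | 0 <= dot (x - p) u] `&` [set x | dot (x - p) u <= r1])
  `&` ([set x | 0 <= dot (x - p) v] `&` [set x | dot (x - p) v <= r2])); last first.
  by apply/seteqP; split => x /= => [[*]|[[? ?] [? ?]]]; split.
by do !apply: bmeasI; apply: bmeas_le; (exact: bfun_cst || exact: bfun_dot).
Qed.

Lemma disc_sub_box x r : disc x r `<=` box (x.1 - r) (x.1 + r) (x.2 - r) (x.2 + r).
Proof.
move=> y; rewrite discE => h.
have := le_trans (norm1_le_enorm _) h; have := le_trans (norm2_le_enorm _) h.
rewrite !planeE !ler_norml => /andP[h1 h2] /andP[h3 h4].
by split; rewrite /= in_itv /=; apply/andP; split; lra.
Qed.

Lemma box_sub_disc x r :
  box (x.1 - r / 2) (x.1 + r / 2) (x.2 - r / 2) (x.2 + r / 2) `<=` disc x r.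
Proof.
move=> y [] /=; rewrite !in_itv /= => /andP[h1 h2] /andP[h3 h4]; rewrite discE.
rewrite -[leRHS](_ : 2 * (r / 2) = r); last by field.
by apply: enorm_le_max; rewrite !planeE ler_norml; apply/andP; split; lra.
Qed.

(** Comparison with the circumscribed square; an inscribed square gives the lower bound. Only orders
    of magnitude matter. *)
Lemma area_sub_disc A x r : bmeas A -> 0 <= r -> A `<=` disc x r ->
  (area A <= (4 * r ^+ 2)%:E)%E.
Proof.
move=> mA r0 Ad.
have Ab : A `<=` box (x.1 - r) (x.1 + r) (x.2 - r) (x.2 + r).
  by move=> y /Ad; exact: disc_sub_box.
apply: le_trans (area_le mA (bmeas_box _ _ _ _) Ab) _.
by rewrite area_box; [rewrite lee_fin; nra|lra|lra].
Qed.

Lemma area_disc_ge x r : 0 <= r -> ((r ^+ 2)%:E <= area (disc x r))%E.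
Proof.
move=> r0; apply: le_trans (area_le _ _ (@box_sub_disc x r)).
- by rewrite area_box; [rewrite lee_fin; nra|lra|lra].
- exact: bmeas_box.
- exact: bmeas_disc.
Qed.

Section Family.
Variables (I : eqType) (f : I -> plane R).
Implicit Type (s : seq I).

Definition discs s r : set (plane R) := \bigcup_(i in [set` s]) disc (f i) r.

Lemma discs_cons i s r : discs (i :: s) r = disc (f i) r `|` discs s r.
Proof.
apply/seteqP; split => x.
  move=> [j /=]; rewrite inE => /orP[/eqP ->|js] h; first by left.
  by right; exists j.
move=> [h|[j js h]]; first by exists i => //=; rewrite mem_head.
by exists j => //=; rewrite inE js orbT.
Qed.

Lemma discs_nil r : discs [::] r = set0.
Proof. by apply/seteqP; split => // x [j]. Qed.

Lemma bmeas_discs s r : bmeas (discs s r).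
Proof.
elim: s => [|i s IH]; first by rewrite discs_nil; exact: bmeas0.
by rewrite discs_cons; apply: bmeasU => //; exact: bmeas_disc.
Qed.

Lemma area_discs_ge s r : 0 <= r -> uniq s ->
  {in s &, forall i j, i != j -> 2 * r < enorm (f i - f j)} ->
  (((size s)%:R * r ^+ 2)%:E <= area (discs s r))%E.
Proof.
move=> r0; elim: s => [_ _|i s IH /= /andP[iNs us] sep].
  by rewrite discs_nil area0 mul0r.
rewrite discs_cons areaU; [|exact: bmeas_disc|exact: bmeas_discs|].
  rewrite mulrS mulrDl mul1r EFinD leeD //; first exact: area_disc_ge.
  by apply: IH => // j k js ks; apply: sep; rewrite inE ?js ?ks orbT.
apply/seteqP; split => // x [h1 [j /= js h2]].
have ij : i != j by apply: contraNneq iNs => ->.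
have := sep i j; rewrite !inE eqxx js orbT => /(_ isT isT ij).
rewrite ltNge => /negP; apply.
apply: le_trans (enorm_triangle x _ _) _.
by rewrite [enorm (x - _)]enormB; move: h1 h2; rewrite !discE; lra.
Qed.

Lemma area_discs_le s r E c : bmeas E -> 0 <= c ->
  (forall i, i \in s -> (area (disc (f i) r `&` E) <= c%:E)%E) ->
  (area (discs s r `&` E) <= ((size s)%:R * c)%:E)%E.
Proof.
move=> mE c0; elim: s => [_|i s IH h].
  by rewrite discs_nil set0I area0 mul0r.
rewrite discs_cons setIUl mulrS mulrDl mul1r EFinD.
apply: le_trans (areaU_le _ _) _.
- by apply: bmeasI => //; exact: bmeas_disc.
- by apply: bmeasI => //; exact: bmeas_discs.
apply: leeD; first by apply: h; exact: mem_head.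
by apply: IH => j js; apply: h; rewrite inE js orbT.
Qed.

End Family.

(* Cover by about r2 / r1 discs of radius 2 r1. *)
Lemma area_sub_rectangle r1 r2 Q A : 0 < r1 -> r1 <= r2 -> is_rectangle r1 r2 Q ->
  bmeas A -> A `<=` Q -> (area A <= (32 * r1 * r2)%:E)%E.
Proof.
move=> r10 r12 [p [u [v [uu vv uv ->]]]] mA AQ.
have [n nP] : exists n : nat, r2 / r1 < n%:R <= r2 / r1 + 1.
  exists (Num.truncn (r2 / r1)).+1.
  have r2r1 : 0 <= r2 / r1 by apply: divr_ge0; [exact: le_trans (ltW r10) r12|exact: ltW].
  have /andP[h1 h2] := truncn_itv r2r1.
  by rewrite h2 andTb -natr1 lerD2r.
pose f (i : nat) := p + (i%:R * r1) *: v.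
have sub : A `<=` discs f (iota 0 n) (2 * r1) `&` A.
  move=> x Ax; split => //; have [[a b] /= [/=]] := AQ _ Ax.
  rewrite !in_itv /= => /andP[a0 a1] /andP[b0 b1] xE.
  (* Rounding [b] down to a multiple of [r1] leaves an offset of at most [r1] in each of the
     directions [u] and [v]. *)
  exists (Num.truncn (b / r1)) => /=.
    rewrite mem_iota add0n /= -(ltr_nat R); apply: le_lt_trans (_ : r2 / r1 < _); last by case/andP: nP.
    apply: le_trans (_ : b / r1 <= _); last by rewrite ler_pM2r ?invr_gt0.
    by rewrite truncn_le divr_ge0 // ltW.
  rewrite discE -xE.
  have /andP[t1 t2] := @truncn_itv R (b / r1) (divr_ge0 b0 (ltW r10)).
  set t := Num.truncn _ in t1 t2 *.
  have -> : f t - (p + a *: u + b *: v) = (- a) *: u + (t%:R * r1 - b) *: v.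
    by apply: plane_ext; rewrite !planeE; ring.
  apply: le_trans (enormD _ _) _; rewrite !enormZ.
  have -> : enorm u = 1 by rewrite /enorm uu sqrtr1.
  have -> : enorm v = 1 by rewrite /enorm vv sqrtr1.
  rewrite !mulr1 normrN ger0_norm //.
  have h1 : t%:R * r1 <= b by rewrite -ler_pdivlMr.
  have h2 : b < t%:R * r1 + r1 by move: t2; rewrite ltr_pdivrMr // -natr1 mulrDl mul1r.
  rewrite ler0_norm; lra.
apply: le_trans (area_le mA _ sub) _.
  by apply: bmeasI => //; exact: bmeas_discs.
apply: le_trans (@area_discs_le _ f _ _ A (4 * (2 * r1) ^+ 2) mA _ _) _.
- nra.
- move=> i _; apply: (@area_sub_disc _ (f i)); [|lra|exact: subIsetl].
  by apply: bmeasI => //; exact: bmeas_disc.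
rewrite size_iota lee_fin.
have /andP[_ h] := nP.
(* At most r2 / r1 + 1 discs of area at most 16 r1^2; since r1 <= r2, the total is at most 32 r1
   r2. *)
apply: le_trans (_ : (r2 / r1 + 1) * (4 * (2 * r1) ^+ 2) <= _).
  by apply: ler_wpM2r => //; nra.
have -> : (r2 / r1 + 1) * (4 * (2 * r1) ^+ 2) = 16 * r1 * r2 + 16 * r1 ^+ 2.
  by field; rewrite gt_eqF.
nra.
Qed.

End Area.

(** * Words and cylinders *)

Section Similitude.
Variable R : realType.
Implicit Types (f : similitude R) (x y : plane R).

Lemma sim_ratio_gt0 f : 0 < sim_ratio f.
Proof. by case/andP: (sim_ratioP f). Qed.

Lemma sim_ratio_lt1 f : sim_ratio f < 1.
Proof. by case/andP: (sim_ratioP f). Qed.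

Lemma orthogonal_mx_rows (M : 'M[R]_2) : orthogonal_mx M ->
  [/\ M 0 0 ^+ 2 + M 0 1 ^+ 2 = 1, M 1 0 ^+ 2 + M 1 1 ^+ 2 = 1 &
      M 0 0 * M 1 0 + M 0 1 * M 1 1 = 0].
Proof.
have e1 : lift ord0 ord0 = 1 :> 'I_2 by apply/val_inj.
move=> /matrixP h; have := h 0 0; have := h 1 1; have := h 0 1.
by rewrite !mxE !big_ord_recl !big_ord0 !mxE /= ?e1 !addr0 !expr2.
Qed.

Lemma orthogonal_mxT (M : 'M[R]_2) : orthogonal_mx M -> orthogonal_mx M^T.
Proof. by move/mulmx1C; rewrite /orthogonal_mx trmxK. Qed.

Lemma enorm_mx_apply (M : 'M[R]_2) x : orthogonal_mx M ->
  enorm (mx_apply M x) = enorm x.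
Proof.
move=> /orthogonal_mxT /orthogonal_mx_rows; rewrite !mxE => -[h1 h2 h3].
rewrite /enorm; congr Num.sqrt; rewrite /mx_apply /dot /=.
transitivity ((M 0 0 ^+ 2 + M 1 0 ^+ 2) * x.1 ^+ 2 + (M 0 1 ^+ 2 + M 1 1 ^+ 2) * x.2 ^+ 2
  + 2 * (M 0 0 * M 0 1 + M 1 0 * M 1 1) * (x.1 * x.2)); first by ring.
by rewrite h1 h2 h3; ring.
Qed.

Lemma mx_applyK (M : 'M[R]_2) x : orthogonal_mx M -> mx_apply M (mx_apply M^T x) = x.
Proof.
move=> /orthogonal_mx_rows [h1 h2 h3].
apply: plane_ext; rewrite /mx_apply /= !mxE.
  transitivity ((M 0 0 ^+ 2 + M 0 1 ^+ 2) * x.1 + (M 0 0 * M 1 0 + M 0 1 * M 1 1) * x.2).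
    by ring.
  by rewrite h1 h3; ring.
transitivity ((M 1 0 ^+ 2 + M 1 1 ^+ 2) * x.2 + (M 0 0 * M 1 0 + M 0 1 * M 1 1) * x.1).
  by ring.
by rewrite h2 h3; ring.
Qed.

Lemma sim_dist f x y :
  enorm (sim_apply f x - sim_apply f y) = sim_ratio f * enorm (x - y).
Proof.
rewrite -(enorm_mx_apply (x - y) (sim_mxP f)).
rewrite -[X in X * _]ger0_norm ?(ltW (sim_ratio_gt0 f)) // -enormZ; congr enorm.
by apply: plane_ext; rewrite /sim_apply /mx_apply !planeE /= ?planeE; ring.
Qed.

Lemma sim_surj f y : exists x, sim_apply f x = y.
Proof.
exists (mx_apply (sim_mx f)^T ((sim_ratio f)^-1 *: (y - sim_shift f))).
rewrite /sim_apply mx_applyK; last exact: sim_mxP.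
by rewrite scalerA divff ?gt_eqF ?sim_ratio_gt0 // scale1r subrK.
Qed.

Lemma sim_affine f (t : R) x y :
  sim_apply f (x + t *: (y - x)) = sim_apply f x + t *: (sim_apply f y - sim_apply f x).
Proof. by apply: plane_ext; rewrite /sim_apply /mx_apply !planeE /= ?planeE; ring. Qed.

End Similitude.

Section Words.
Variables (R : realType) (s : nat) (T : 'I_s -> similitude R).
Implicit Types (u v w : seq 'I_s) (x y p o : plane R) (r t : R) (i : 'I_s).

Local Notation ratio i := (sim_ratio (T i)).

Definition lam w : R := \prod_(i <- w) ratio i.
Definition act w x : plane R := foldr (fun i => sim_apply (T i)) x w.

Lemma lam_nil : lam [::] = 1. Proof. by rewrite /lam big_nil. Qed.
Lemma lam_cons i w : lam (i :: w) = ratio i * lam w.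
Proof. by rewrite /lam big_cons. Qed.
Lemma lam_cat u v : lam (u ++ v) = lam u * lam v.
Proof. by rewrite /lam big_cat. Qed.
Lemma lam_gt0 w : 0 < lam w.
Proof. by apply: prodr_gt0 => i _; exact: sim_ratio_gt0. Qed.
Lemma act_cat u v x : act (u ++ v) x = act u (act v x).
Proof. by rewrite /act foldr_cat. Qed.

Lemma act_dist w x y : enorm (act w x - act w y) = lam w * enorm (x - y).
Proof.
elim: w => [|i w IH] /=; first by rewrite lam_nil mul1r.
by rewrite sim_dist IH lam_cons mulrA.
Qed.

Lemma act_surj w y : exists x, act w x = y.
Proof.
elim: w y => [|i w IH] y; first by exists y.
by have [z <-] := sim_surj (T i) y; have [x <-] := IH z; exists x.
Qed.

Lemma act_affine w t x y : act w (x + t *: (y - x)) = act w x + t *: (act w y - act w x).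
Proof. by elim: w => [//|i w IH] /=; rewrite IH sim_affine. Qed.

(** [act w] is onto and affine, so two points of [l] have preimages spanning [l']; it scales
    distances by [lam w], which cancels from the width. *)
Lemma act_line w l : is_line l -> exists2 l', is_line l' &
  forall t x, thicken l (lam w * t) (act w x) -> thicken l' t x.
Proof.
move=> [p [v [v0 ->]]].
have [p' pE] := act_surj w p; have [q' qE] := act_surj w (p + v).
exists [set p' + t *: (q' - p') | t in [set: R]].
  exists p', (q' - p'); split => //; apply: contra_neq v0 => /eqP; rewrite subr_eq0 => /eqP e.
  by move: qE; rewrite e pE => /eqP; rewrite -subr_eq0 opprD addrA subrr sub0r oppr_eq0 => /eqP.
move=> t x; rewrite !thickenP => -[_ [a _ <-] h].
exists (p' + a *: (q' - p')); first by exists a.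
rewrite -(ler_pM2l (lam_gt0 w)) -act_dist act_affine pE qE.
by rewrite [p + v - p]addrC addKr.
Qed.

Variable c : R.
Hypothesis c0 : 0 < c.
Hypothesis cP : forall i, c <= ratio i <= 1 - c.

Let c1 i : ratio i <= 1 - c. Proof. by case/andP: (cP i). Qed.

Lemma lam_le1 w : lam w <= 1.
Proof.
apply: prodr_ile1 => i _; rewrite (ltW (sim_ratio_gt0 _)) /=.
exact: ltW (sim_ratio_lt1 _).
Qed.

(** The recursion on [r] is not structural. Each letter divides [r] by a ratio at most [1 - c], so
    [n] letters reach a level at least 1 once [(1 - c) ^+ n <= r], and further fuel changes
    nothing. *)
Fixpoint cut_fuel (n : nat) r : seq (seq 'I_s) :=
  if n is n'.+1 then
    if 1 <= r then [:: [::]]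
    else [seq i :: w | i <- enum 'I_s, w <- cut_fuel n' (r / ratio i)]
  else [:: [::]].

Lemma cut_fuelS n r : (1 - c) ^+ n <= r -> cut_fuel n.+1 r = cut_fuel n r.
Proof.
elim: n r => [|n IH] r h; first by rewrite /=; rewrite expr0 in h; rewrite h.
transitivity (if 1 <= r then [:: [::]]
  else [seq i :: w | i <- enum 'I_s, w <- cut_fuel n.+1 (r / ratio i)]); first by [].
rewrite [RHS]/=; case: ifP => // _.
congr flatten; apply: eq_map => i; congr map; apply: IH.
rewrite ler_pdivlMr ?sim_ratio_gt0 //; apply: le_trans h.
rewrite exprSr ler_wpM2l // exprn_ge0 //.
by apply: le_trans (c1 i); exact: ltW (sim_ratio_gt0 _).
Qed.

Lemma cut_fuelD n m r : (1 - c) ^+ n <= r -> cut_fuel (n + m) r = cut_fuel n r.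
Proof.
(* A letter [i] is what shows [0 <= 1 - c], so the empty alphabet is treated apart. *)
have [/card0_eq noI|/card_gt0P[i _]] := posnP #|'I_s|.
  case: m => [|m]; first by rewrite addn0.
  rewrite addnS /=; case: n => [|n] /=.
    by rewrite expr0 => ->.
  move=> _; case: ifP => // _.
  by have -> : enum 'I_s = [::] by apply/eqP; rewrite -size_eq0 -cardE; apply/eqP/eq_card0.
have d0 : 0 <= 1 - c by apply: le_trans (c1 i); exact: ltW (sim_ratio_gt0 _).
have d1 : 1 - c <= 1 by rewrite gerBl ltW.
elim: m => [|m IH] h; first by rewrite addn0.
rewrite addnS cut_fuelS ?IH //; apply: le_trans h.
by rewrite exprD ler_piMr ?exprn_ge0 // exprn_ile1.
Qed.

(** Any sufficient amount gives the same words; the default is taken only where no power is small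
    enough, which [fuelP] excludes for [0 < r]. *)
Definition fuel r := xget 0%N [set n | (1 - c) ^+ n <= r].

Hypothesis c_lt1 : c < 1.

Lemma expr_le_ex (d : R) r : 0 <= d < 1 -> 0 < r -> exists n, d ^+ n <= r.
Proof.
move=> /andP[d0 d1] r0.
have dn : `|d| < 1 by rewrite ger0_norm.
have /cvgrPdist_le /(_ _ r0) [n _ /(_ n (leqnn n))] := cvg_expr dn.
by rewrite sub0r normrN ger0_norm ?exprn_ge0 //; exists n.
Qed.

Lemma fuelP r : 0 < r -> (1 - c) ^+ (fuel r) <= r.
Proof.
move=> r0; have [|n hn] := @expr_le_ex (1 - c) r _ r0.
  by rewrite subr_ge0 ltW // gtrBl.
by rewrite /fuel; case: xgetP => [_ -> //|/(_ n)]; case.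
Qed.

(* The words w with lam w <= r < lam w^-, where w^- is w without its last
   letter; the empty word alone when 1 <= r. *)
Definition cut r := cut_fuel (fuel r) r.

Lemma cut_ge1 r : 1 <= r -> cut r = [:: [::]].
Proof. by rewrite /cut; case: (fuel r) => //= n ->. Qed.

Lemma cutS r : 0 < r < 1 -> cut r = [seq i :: w | i <- enum 'I_s, w <- cut (r / ratio i)].
Proof.
move=> /andP[r0 r1]; rewrite {1}/cut; have := fuelP r0.
case: (fuel r) => [|n]; first by rewrite expr0 leNgt r1.
move=> h; rewrite /= leNgt r1 /=; congr flatten; apply: eq_map => i; congr map.
have hi : (1 - c) ^+ n <= r / ratio i.
  rewrite ler_pdivlMr ?sim_ratio_gt0 //; apply: le_trans h.
  by rewrite exprSr ler_wpM2l // exprn_ge0 // subr_ge0 ltW.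
rewrite /cut -(cut_fuelD (fuel (r / ratio i)) hi) addnC cut_fuelD //.
by apply: fuelP; rewrite divr_gt0 // sim_ratio_gt0.
Qed.

(** Induction from coarse levels to fine ones: finitely many divisions by ratios lift any positive
    level above 1. *)
Lemma cut_ind (P : R -> Prop) :
  (forall r, 1 <= r -> P r) ->
  (forall r, 0 < r < 1 -> (forall i, P (r / ratio i)) -> P r) ->
  forall r, 0 < r -> P r.
Proof.
move=> h1 hS; suff H n r : 0 < r -> (1 - c) ^+ n <= r -> P r.
  by move=> r r0; exact: H r0 (fuelP r0).
elim: n r => [|n IH] r r0 h; first by rewrite expr0 in h; exact: h1.
have [/h1//|r1] := leP 1 r.
apply: hS; first by rewrite r0.
move=> i; apply: IH; first by rewrite divr_gt0 // sim_ratio_gt0.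
rewrite ler_pdivlMr ?sim_ratio_gt0 //; apply: le_trans h.
by rewrite exprSr ler_wpM2l // exprn_ge0 // subr_ge0 ltW.
Qed.

Lemma mem_cutS r w : 0 < r < 1 -> w \in cut r ->
  exists i v, w = i :: v /\ v \in cut (r / ratio i).
Proof. by move=> h; rewrite cutS // => /allpairsPdep[i [v [_ ? ->]]]; exists i, v. Qed.

Lemma lam_cut_le r w : 0 < r -> w \in cut r -> lam w <= r.
Proof.
move=> r0; move: r r0 w; apply: cut_ind => [r r1 w|r h IH w].
  by rewrite cut_ge1 // inE => /eqP ->; rewrite lam_nil.
move=> /(mem_cutS h)[i [v [-> /IH]]].
by rewrite lam_cons ler_pdivlMr ?sim_ratio_gt0 // mulrC.
Qed.

(** Before its last letter the word was still longer than [r], and that letter costs at most the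
    factor [c]. The condition [c * r <= 1] is stable under the recursion: for [r < 1] the level
    [r / ratio i] satisfies it because [c <= ratio i]. *)
Lemma lam_cut_ge r w : 0 < r -> c * r <= 1 -> w \in cut r -> c * r <= lam w.
Proof.
move=> r0; move: r r0 w; apply: cut_ind => [r r1 w|r h IH w] cr.
  by rewrite cut_ge1 // inE => /eqP ->; rewrite lam_nil.
move=> /(mem_cutS h)[i [v [-> /IH]]].
have /andP[r0 r1] := h; have /andP[h1 h2] := cP i.
rewrite mulrA ler_pdivrMr ?sim_ratio_gt0 // mul1r lam_cons => h3.
rewrite -ler_pdivrMl ?sim_ratio_gt0 // mulrC; apply: h3.
by apply: le_trans h1; rewrite ler_piMr // ltW.
Qed.

Lemma sum_cutS (F : seq 'I_s -> R) r : 0 < r < 1 ->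
  \sum_(w <- cut r) F w = \sum_i \sum_(w <- cut (r / ratio i)) F (i :: w).
Proof. by move=> h; rewrite cutS // big_allpairs_dep big_enum. Qed.

Lemma sum_cut_refine r r' (F : seq 'I_s -> R) : 0 < r -> r <= r' ->
  \sum_(w <- cut r) F w =
  \sum_(u <- cut r') \sum_(v <- cut (r / lam u)) F (u ++ v).
Proof.
move=> r0 rr'; have r'0 := lt_le_trans r0 rr'.
move: r' r'0 r F r0 rr'; apply: cut_ind => [r' h r F r0 rr'|r' h IH r F r0 rr'].
  by rewrite [cut r']cut_ge1 // big_seq1 lam_nil divr1.
have /andP[h0 h1] := h.
rewrite [LHS]sum_cutS ?r0 ?(le_lt_trans rr') // [RHS]sum_cutS //.
apply: eq_bigr => i _; rewrite (IH i _ (fun w => F (i :: w))).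
- by apply: eq_bigr => u _; rewrite lam_cons invfM mulrA.
- by rewrite divr_gt0 // sim_ratio_gt0.
- by rewrite ler_pM2r // invr_gt0 sim_ratio_gt0.
Qed.

(** * Separation of cylinders by the open set *)

Section OpenSet.
Variable O : set (plane R).
Hypothesis TO : \bigcup_i (sim_apply (T i) @` O) `<=` O.
Hypothesis TOd : trivIset [set: 'I_s] (fun i => sim_apply (T i) @` O).

Lemma act_sub_O w x : O x -> O (act w x).
Proof. by move=> Ox; elim: w => [//|i w IH] /=; apply: TO; exists i => //; exists (act w x). Qed.

Lemma sim_inj i x y : sim_apply (T i) x = sim_apply (T i) y -> x = y.
Proof.
move=> e; have := sim_dist (T i) x y; rewrite e subrr enorm0 => /esym/eqP.
rewrite mulf_eq0 gt_eqF ?sim_ratio_gt0 //= => /eqP /enorm0_eq0 /eqP.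
by rewrite subr_eq0 => /eqP.
Qed.

(** At the first letter where the words differ the two points lie in disjoint images of [O]; common
    letters are cancelled by injectivity. The recursion ends for both words at the same level, so
    neither can be a proper prefix of the other. *)
Lemma cut_disjoint r u v x y : 0 < r -> u \in cut r -> v \in cut r ->
  O x -> O y -> act u x = act v y -> u = v.
Proof.
move=> r0 ur vr Ox Oy; move: r r0 u v ur vr; apply: cut_ind => [r h u v|r h IH u v].
  by rewrite cut_ge1 // !inE => /eqP -> /eqP ->.
move=> /(mem_cutS h)[i [u' [-> iu]]] /(mem_cutS h)[j [v' [-> jv]]] /= e.
have ij : i = j.
  apply: (TOd (i := i) (j := j)) => //; exists (sim_apply (T i) (act u' x)).
  by split; [exists (act u' x) => //|rewrite e; exists (act v' y) => //]; exact: act_sub_O.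
by subst j; congr cons; apply: (IH i) => //; exact: sim_inj e.
Qed.

Lemma cut_uniq r : 0 < r -> uniq (cut r).
Proof.
move: r; apply: cut_ind => [r h|r h IH]; first by rewrite cut_ge1.
rewrite cutS //; apply: allpairs_uniq_dep; first exact: enum_uniq.
  by move=> i _; exact: IH.
by move=> [i u] [j v] _ _ /= [-> ->].
Qed.

Variables (o : plane R) (e : R).
Hypothesis e0 : 0 < e.
Hypothesis oO : disc o e `<=` O.

(** The disc of radius [e * lam u], at least [c * e * r], around [act u o] is the image of
    [disc o e], hence part of the image of [O] under [u], which [act v o] cannot enter. *)
Lemma cut_separated r u v : 0 < r -> c * r <= 1 -> u \in cut r -> v \in cut r ->
  u != v -> c * e * r < enorm (act u o - act v o).
Proof.
move=> r0 cr ur vr uv; rewrite ltNge; apply: contra uv => h.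
have [x xE] := act_surj u (act v o).
apply/eqP/(@cut_disjoint r u v x o) => //.
- apply: oO; rewrite discE -(ler_pM2l (lam_gt0 u)) -act_dist xE.
  apply: le_trans h _; rewrite mulrAC; apply: ler_wpM2r; [exact: ltW|exact: lam_cut_ge ur].
- by apply: oO; apply: disc_refl; exact: ltW.
Qed.

End OpenSet.

End Words.

(** * The self-similar mass *)

Section Generic.
Variable R : realType.
Implicit Types (x y p v : plane R) (r t : R).

(** The discs of radius d / 2 are disjoint and lie in a disc of radius r + d / 2; compare areas. *)
Lemma packing (I : eqType) (f : I -> plane R) (s : seq I) (d r : R) x :
  0 < d -> 0 <= r -> uniq s ->
  {in s &, forall i j, i != j -> d < enorm (f i - f j)} ->
  {in s, forall i, enorm (f i - x) <= r} ->
  (size s)%:R <= 4 * (2 * r / d + 1) ^+ 2.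
Proof.
move=> d0 r0 us sep sx.
have d20 : 0 <= d / 2 by rewrite divr_ge0 // ltW.
have sep2 : {in s &, forall i j, i != j -> 2 * (d / 2) < enorm (f i - f j)}.
  by move=> i j si sj ij; rewrite mulrC divfK ?pnatr_eq0 //; exact: sep.
have h := area_discs_ge d20 us sep2.
have sub : discs f s (d / 2) `<=` disc x (r + d / 2).
  move=> y [i /= si h1]; rewrite discE; apply: le_trans (enorm_triangle (f i) _ _) _.
  by apply: lerD; [rewrite enormB; exact: sx|].
have := le_trans h (area_sub_disc (bmeas_discs _ _ _) (addr_ge0 r0 d20) sub).
rewrite lee_fin => h3.
rewrite -(@ler_pM2r _ ((d / 2) ^+ 2)) ?exprn_gt0 ?divr_gt0 //.
apply: le_trans h3 _; rewrite le_eqVlt; apply/orP; left; apply/eqP.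
by field; rewrite gt_eqF.
Qed.

Lemma powR_inv (a k : R) : 0 <= a -> a^-1 `^ k = (a `^ k)^-1.
Proof. by move=> a0; rewrite -powR_inv1 // powRAC powR_inv1 ?powR_ge0. Qed.

Lemma powR_div (a b k : R) : 0 <= a -> 0 <= b -> (a / b) `^ k = a `^ k / b `^ k.
Proof. by move=> a0 b0; rewrite powRM ?invr_ge0 // powR_inv. Qed.

(** a^k = exp (k ln a) is at least 1 + k ln a, which is at least 1 - p for small k. The bound 1/2 is
    the one imposed on the exponent kappa. *)
Lemma powR_ge_ex (a p : R) : 0 < a < 1 -> 0 < p ->
  exists2 k, 0 < k <= 2^-1 & 1 - p <= a `^ k.
Proof.
move=> /andP[a0 a1] p0.
have la : ln a < 0 by rewrite ln_lt0 // a0.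
have q0 : 0 < p / (- ln a) by rewrite divr_gt0 // oppr_gt0.
exists (Num.min 2^-1 (p / (- ln a))).
  by rewrite lt_min q0 invr_gt0 ltr0n /= ge_min lexx.
set k := Num.min _ _.
have kp : k <= p / (- ln a) by rewrite ge_min lexx orbT.
rewrite /powR gt_eqF //; apply: le_trans (expR_ge1Dx _).
rewrite lerD2l -[k * _]opprK lerN2 -mulrN -ler_pdivlMr // oppr_gt0 //.
Qed.

(* If the t-neighbourhood of a line of direction v contains p1, p2, p3, then t
   bounds from above the area of their triangle, whose sides a, b satisfy
   cross a b *: v + cross b v *: a + cross v a *: b = 0. *)
Lemma not_in_line_escape (J : set (plane R)) :
  J !=set0 -> ~ (exists l, is_line l /\ J `<=` l) ->
  exists2 t, 0 < t & forall l, is_line l -> exists2 p, J p & ~ thicken l t p.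
Proof.
move=> [p1 J1] hl.
have [p2 J2 p12] : exists2 p2, J p2 & p2 - p1 != 0.
  apply: contrapT => h; apply: hl; have [l ll lp] := line_through p1 (1, 0).
  exists l; split => // y Jy; have -> : y = p1 + 0 *: (1, 0).
    rewrite scale0r addr0; apply/eqP; rewrite -subr_eq0; apply/negPn/negP => n.
    by apply: h; exists y.
  exact: lp.
have [p3 J3 p13] : exists2 p3, J p3 & cross (p2 - p1) (p3 - p1) != 0.
  apply: contrapT => h; apply: hl; exists [set p1 + t *: (p2 - p1) | t in [set: R]]; split.
    by exists p1, (p2 - p1).
  move=> y Jy; have /eqP cy : cross (p2 - p1) (y - p1) == 0.
    by apply/negPn/negP => n; apply: h; exists y.
  have cy' : `|cross (y - p1) (p2 - p1)| <= 0 * enorm (p2 - p1).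
    rewrite mul0r normr_le0; apply/eqP; rewrite -[LHS]opprK -[RHS]oppr0; congr (- _).
    by rewrite -cy /cross; ring.
  move/(thicken_line p1 0 y p12)/thickenP: cy' => [z lz zy].
  have /eqP : enorm (z - y) = 0 by apply/eqP; rewrite eq_le zy enorm_ge0.
  by move=> /eqP/enorm0_eq0/eqP; rewrite subr_eq0 => /eqP <-.
set a := p2 - p1 in p13; set b := p3 - p1 in p13.
have ab0 : 0 < 4 * (enorm a + enorm b + 1).
  by have := enorm_ge0 a; have := enorm_ge0 b; lra.
have cab : 0 < `|cross a b| by rewrite normr_gt0.
(* A strip of half-width t containing the three points would force |cross a b| <= 2 t (|a| + |b|),
   which this t violates. *)
exists (`|cross a b| / (4 * (enorm a + enorm b + 1))); first by rewrite divr_gt0.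
set t := _ / _ => l [q [v [v0 lE]]].
apply: contrapT => h.
have hp p : J p -> `|cross (p - q) v| <= t * enorm v.
  move=> Jp; apply/(thicken_line _ _ _ v0); rewrite -lE; apply: contrapT => n.
  by apply: h; exists p.
have h1 := hp _ J1; have h2 := hp _ J2; have h3 := hp _ J3.
have ha : `|cross a v| <= 2 * (t * enorm v).
  have -> : cross a v = cross (p2 - q) v - cross (p1 - q) v by rewrite /cross !planeE; ring.
  by apply: le_trans (ler_normB _ _) _; lra.
have hb : `|cross b v| <= 2 * (t * enorm v).
  have -> : cross b v = cross (p3 - q) v - cross (p1 - q) v by rewrite /cross !planeE; ring.
  by apply: le_trans (ler_normB _ _) _; lra.
have nv := enorm_gt0 v0.
have E : cross a b *: v = (- cross b v) *: a + cross a v *: b.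
  by apply: plane_ext; rewrite /cross !planeE; ring.
have : `|cross a b| * enorm v <= 2 * (t * enorm v) * (enorm a + enorm b).
  rewrite -enormZ E; apply: le_trans (enormD _ _) _; rewrite !enormZ normrN mulrDr.
  by apply: lerD; apply: ler_wpM2r => //; exact: enorm_ge0.
have -> : 2 * (t * enorm v) * (enorm a + enorm b) =
   2 * t * (enorm a + enorm b) * enorm v by ring.
rewrite ler_pM2r // leNgt => /negP; apply.
have tE : t * (4 * (enorm a + enorm b + 1)) = `|cross a b|.
  by rewrite /t divfK // gt_eqF.
rewrite -tE.
have t0 : 0 < t by rewrite /t divr_gt0.
by have := enorm_ge0 a; have := enorm_ge0 b; nra.
Qed.

End Generic.

Section Mass.
Variables (R : realType) (s : nat) (T : 'I_s -> similitude R).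
Implicit Types (u v w : seq 'I_s) (x y : plane R) (r t : R) (i : 'I_s)
  (P Q : seq 'I_s -> Prop) (l : set (plane R)).
Variable c : R.
Hypotheses (c0 : 0 < c) (c1 : c < 1).
Hypothesis cP : forall i, c <= sim_ratio (T i) <= 1 - c.
Variable D : R.
Hypotheses (D0 : 0 <= D) (hD : \sum_i sim_ratio (T i) `^ D = 1).

Local Notation cut := (cut T c).
Local Notation lam := (lam T).
Local Notation act := (act T).

(* The natural probability measure of the cylinders of words satisfying P. *)
Definition mass r P : R := \sum_(w <- cut r | `[< P w >]) lam w `^ D.

Lemma le_mass r P Q : (forall w, P w -> Q w) -> mass r P <= mass r Q.
Proof.
move=> PQ; rewrite /mass [leLHS]big_mkcond [leRHS]big_mkcond.
apply: ler_sum => w _; case: asboolP => [/PQ Qw|_]; first by rewrite asboolT.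
by case: ifP => // _; exact: powR_ge0.
Qed.

Lemma lam_consX i w : lam (i :: w) `^ D = sim_ratio (T i) `^ D * lam w `^ D.
Proof. by rewrite lam_cons powRM // ltW // ?lam_gt0 ?sim_ratio_gt0. Qed.

Lemma lam_catX u v : lam (u ++ v) `^ D = lam u `^ D * lam v `^ D.
Proof. by rewrite lam_cat powRM // ltW // lam_gt0. Qed.

Lemma sum_cut r : 0 < r -> \sum_(w <- cut r) lam w `^ D = 1.
Proof.
move: r; apply: (cut_ind c0 cP c1) => [r r1|r h IH].
  by rewrite cut_ge1 // big_seq1 lam_nil powR1.
rewrite (sum_cutS c0 cP c1) //; rewrite -[RHS]hD; apply: eq_bigr => i _.
under eq_bigr do rewrite lam_consX.
by rewrite -mulr_sumr IH mulr1.
Qed.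

Lemma mass_le1 r P : 0 < r -> mass r P <= 1.
Proof.
move=> /sum_cut <-; rewrite /mass big_mkcond; apply: ler_sum => w _.
by case: ifP => // _; exact: powR_ge0.
Qed.

(** This consistency between levels replaces a limit measure: inside the cylinder of [u] the mass is
    a rescaled copy of the whole. *)
Lemma mass_refine r r' P : 0 < r -> r <= r' ->
  mass r P = \sum_(u <- cut r') lam u `^ D * mass (r / lam u) (fun v => P (u ++ v)).
Proof.
move=> r0 rr'; rewrite /mass big_mkcond (sum_cut_refine c0 cP c1 _ r0 rr').
apply: eq_bigr => u _; rewrite mulr_sumr [RHS]big_mkcond.
by apply: eq_bigr => v _; case: ifP => // _; rewrite lam_catX.
Qed.

Lemma mass_exists (I : eqType) (F : seq I) (P : I -> seq 'I_s -> Prop) r :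
  mass r (fun w => exists2 i, i \in F & P i w) <= \sum_(i <- F) mass r (P i).
Proof.
rewrite /mass; under [leRHS]eq_bigr do rewrite big_mkcond.
rewrite exchange_big big_mkcond; apply: ler_sum => w _.
case: asboolP => [[i]|_]; last first.
  by apply: sumr_ge0 => i _; case: ifP => // _; exact: powR_ge0.
elim: F => [//|j F IH]; rewrite inE => /orP[/eqP ->|iF] Pw; rewrite big_cons.
  rewrite asboolT // lerDl; apply: sumr_ge0 => k _; case: ifP => // _; exact: powR_ge0.
apply: le_trans (IH iF Pw) _; rewrite lerDr; case: ifP => // _; exact: powR_ge0.
Qed.

(** Every word weighs at least (c r)^D, so mass bounds the number of words, and thereby later the
    area of discs. *)
Lemma le_size_mass r P : 0 < r -> c * r <= 1 ->
  (size [seq w <- cut r | `[< P w >]])%:R * (c * r) `^ D <= mass r P.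
Proof.
move=> r0 cr; rewrite /mass -big_filter.
rewrite -[leLHS](_ : \sum_(w <- [seq w <- cut r | `[< P w >]]) (c * r) `^ D = _); last first.
  by rewrite big_const_seq count_predT iter_addr_0 -[LHS]mulr_natl.
rewrite big_seq [leRHS]big_seq; apply: ler_sum => w; rewrite mem_filter => /andP[_ wr].
apply: ge0_ler_powR => //; rewrite ?nnegrE; first exact: ltW (mulr_gt0 _ _).
  exact: ltW (lam_gt0 _ _).
exact: (lam_cut_ge c0 cP c1).
Qed.

Lemma size_cut_ge r : 0 < r -> 1 <= (size (cut r))%:R * r `^ D.
Proof.
move=> r0; rewrite -[leLHS](sum_cut r0).
rewrite -[leRHS](_ : \sum_(w <- cut r) r `^ D = _); last first.
  by rewrite big_const_seq count_predT iter_addr_0 -[LHS]mulr_natl.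
rewrite big_seq [leRHS]big_seq; apply: ler_sum => w wr.
apply: ge0_ler_powR => //; rewrite ?nnegrE ?(ltW r0) ?(ltW (lam_gt0 _ _)) //.
exact: (lam_cut_le c0 cP c1).
Qed.

Variable O : set (plane R).
Hypothesis TO : \bigcup_i (sim_apply (T i) @` O) `<=` O.
Hypothesis TOd : trivIset [set: 'I_s] (fun i => sim_apply (T i) @` O).
Variables (o : plane R) (e : R).
Hypothesis e0 : 0 < e.
Hypothesis oO : disc o e `<=` O.
Variable M : R.
Hypothesis M0 : 0 < M.
Hypothesis oM : forall w, enorm (act w o - o) <= M.

Lemma act_cat_near u v : enorm (act (u ++ v) o - act u o) <= M * lam u.
Proof. by rewrite act_cat act_dist mulrC ler_wpM2r // ltW // lam_gt0. Qed.

Lemma size_cut_near K : 0 <= K -> exists2 N : R, 0 < N & forall r x,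
  0 < r -> c * r <= 1 ->
  (size [seq w <- cut r | `[< enorm (act w o - x) <= K * r >]])%:R <= N.
Proof.
move=> K0; exists (4 * (2 * K / (c * e) + 1) ^+ 2).
  rewrite mulr_gt0 // exprn_gt0 // ltr_pwDr // divr_ge0 ?mulr_ge0 // ltW // mulr_gt0 //.
move=> r x r0 cr.
have -> : 2 * K / (c * e) = 2 * (K * r) / (c * e * r).
  by field; rewrite !gt_eqF.
apply: (@packing _ _ (fun w => act w o) _ (c * e * r) (K * r) x).
- by rewrite !mulr_gt0.
- by rewrite mulr_ge0 // ltW.
- by rewrite filter_uniq // (cut_uniq c0 cP c1).
- move=> u v; rewrite !mem_filter => /andP[_ ur] /andP[_ vr] uv.
  exact: (cut_separated c0 cP c1 TO TOd e0 oO r0 cr).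
- by move=> w; rewrite mem_filter => /andP[/asboolP].
Qed.

(** The common last step of the estimates localised in a ball: only the cylinders with [Q]
    contribute, and each weighs at most r^D. *)
Lemma mass_refine_near r K Q F : 0 < r ->
  (forall u, u \in cut r -> ~ Q u -> F u = 0) ->
  (forall u, u \in cut r -> Q u -> F u <= K) -> 0 <= K ->
  \sum_(u <- cut r) lam u `^ D * F u <=
    (size [seq w <- cut r | `[< Q w >]])%:R * r `^ D * K.
Proof.
move=> r0 h1 h2 K0.
rewrite -[leRHS](_ : \sum_(w <- [seq w <- cut r | `[< Q w >]]) r `^ D * K = _); last first.
  by rewrite big_const_seq count_predT iter_addr_0 -[LHS]mulr_natl mulrA.
rewrite big_filter [leRHS]big_mkcond big_seq [leRHS]big_seq.
apply: ler_sum => u ur; case: asboolP => q; last by rewrite h1 // mulr0.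
apply: (@le_trans _ _ (lam u `^ D * K)).
  by rewrite ler_wpM2l ?powR_ge0 // h2.
rewrite ler_wpM2r // ge0_ler_powR // ?nnegrE ?(ltW r0) ?(ltW (lam_gt0 _ _)) //.
exact: (lam_cut_le c0 cP c1).
Qed.

Lemma mass_pred0 r P : (forall w, ~ P w) -> mass r P = 0.
Proof. by move=> h; rewrite /mass big1 // => w /asboolP /h. Qed.

Lemma mass_ball : exists2 N : R, 0 < N & forall r t x, 0 < r -> r <= t ->
  mass r (fun w => enorm (act w o - x) <= t) <= N * t `^ D.
Proof.
have M1 : 0 <= 1 + M by rewrite addr_ge0 // ltW.
have [N N0 hN] := size_cut_near M1.
exists (N + 1); first by rewrite addr_gt0.
move=> r t x r0 rt; have t0 := lt_le_trans r0 rt.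
have [t1|t1] := leP 1 t.
  apply: le_trans (mass_le1 _ r0) _.
  have : 1 <= t `^ D by rewrite -[leLHS](powRr0 t) ler_powR.
  by move=> h; nra.
rewrite (mass_refine _ r0 rt).
(* Extending [u] moves the point by at most [M * lam u <= M * t], so a cylinder of level [t] that
   meets the ball has its centre within [(1 + M) * t]. *)
apply: le_trans (mass_refine_near (Q := fun u => enorm (act u o - x) <= (1 + M) * t) (K := 1) t0 _ _ _) _ => //.
- move=> u ut nQ; apply: mass_pred0 => v h; apply: nQ.
  apply: le_trans (enorm_triangle (act (u ++ v) o) _ _) _.
  rewrite enormB mulrDl mul1r addrC; apply: lerD => //; apply: le_trans (act_cat_near _ _) _.
  by rewrite ler_wpM2l ?(ltW M0) // (lam_cut_le c0 cP c1).
- by move=> u _ _; apply: mass_le1; rewrite divr_gt0 // lam_gt0.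
rewrite mulr1 ler_wpM2r ?powR_ge0 //.
apply: le_trans (hN t x t0 _) _; last by rewrite lerDl.
by rewrite mulr_ile1 // ltW.
Qed.

Variable J : set (plane R).
Hypothesis J0 : J !=set0.
Hypothesis J_line : ~ (exists l, is_line l /\ J `<=` l).
Hypothesis J_cover : forall r y, 0 < r -> J y ->
  exists2 u, u \in cut r & enorm (y - act u o) <= M * r.

(* Some cylinder of level r0 avoids the line. Rescaling the other ones multiplies
   t by at least 1 / r0 and costs at most the factor (c r0)^-k, which is paid by
   the mass at least (c r0)^D of the missing cylinder. *)
Lemma mass_line : exists C k : R, [/\ 0 < C, 0 < k <= 2^-1 &
  forall l r t, is_line l -> 0 < r -> r <= t ->
    mass r (fun w => thicken l t (act w o)) <= C * t `^ k].
Proof.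
have [t1 t10 ht1] := not_in_line_escape J0 J_line.
have M2 : 0 < 1 + 2 * M by have := M0; lra.
(* A cylinder of level [r0] whose centre is within [M * r0] of a point of J stays within
   [2 * M * r0] of that point; adding the half-width [t <= r0] of the strip must not exceed [t1]. *)
pose r0 := Num.min 2^-1 (t1 / (1 + 2 * M)).
have r00 : 0 < r0 by rewrite lt_min invr_gt0 ltr0n divr_gt0.
have r01 : r0 < 1 by rewrite gt_min invf_lt1 ?ltr0n // ltr1n.
have r0t : (1 + 2 * M) * r0 <= t1.
  by rewrite mulrC -ler_pdivlMr // ge_min lexx orbT.
have a0 : 0 < c * r0 by rewrite mulr_gt0.
have a1 : c * r0 < 1 by rewrite mulr_ilt1 // ltW.
have [k k0 hk] := powR_ge_ex (p := (c * r0) `^ D) (introT andP (conj a0 a1)) (powR_gt0 _ a0).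
(* With this factor the bound is at least 1 for [r0 <= t], where the total mass suffices. *)
exists (r0 `^ k)^-1, k; split => //; first by rewrite invr_gt0 powR_gt0.
have k00 : 0 < k by case/andP: k0.
set C := (r0 `^ k)^-1; have C0 : 0 < C by rewrite invr_gt0 powR_gt0.
(* [n] counts rescalings: each divides [t] by some [lam u <= r0] and replaces the line by its
   preimage. *)
suff H n l r t : is_line l -> r0 ^+ n <= t -> 0 < r -> r <= t ->
    mass r (fun w => thicken l t (act w o)) <= C * t `^ k.
  move=> l r t ll rp rt; have t0 := lt_le_trans rp rt.
  have [|n hn] := @expr_le_ex _ r0 t _ t0; first by rewrite (ltW r00).
  exact: (H n).
elim: n l r t => [|n IH] l r t ll hn rp rt; have t0 := lt_le_trans rp rt.
  rewrite expr0 in hn; apply: le_trans (mass_le1 _ rp) _.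
  rewrite /C mulrC ler_pdivlMr ?powR_gt0 // mul1r ge0_ler_powR ?nnegrE ?ltW //.
  exact: lt_le_trans hn.
have [tr|tr] := ltP r0 t.
  apply: le_trans (mass_le1 _ rp) _.
  by rewrite /C mulrC ler_pdivlMr ?powR_gt0 // mul1r ge0_ler_powR ?nnegrE ?(ltW k00) // ltW.
have [y Jy yl] := ht1 l ll.
have [u0 u0r yu] := J_cover r00 Jy.
rewrite (mass_refine _ rp (le_trans rt tr)).
rewrite (bigD1_seq u0) //=; last exact: (cut_uniq c0 cP c1).
rewrite mass_pred0 ?mulr0 ?add0r; last first.
  move=> v /thickenP[z lz zv]; apply: yl; apply/thickenP; exists z => //.
  apply: le_trans r0t; apply: le_trans (enorm_triangle (act (u0 ++ v) o) _ _) _.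
  rewrite mulrDl mul1r; apply: lerD; first exact: le_trans zv tr.
  apply: le_trans (enorm_triangle (act u0 o) _ _) _.
  have := le_trans (act_cat_near u0 v) _ => /(_ (M * r0)).
  rewrite ler_wpM2l ?(ltW M0) ?(lam_cut_le c0 cP c1) // => /(_ isT).
  by move: yu; rewrite [enorm (act u0 o - y)]enormB; lra.
apply: (@le_trans _ _ (\sum_(u <- cut r0 | u != u0) lam u `^ D * (C * (t / (c * r0)) `^ k))).
  rewrite big_seq_cond [leRHS]big_seq_cond; apply: ler_sum => u /andP[ur _].
  rewrite ler_wpM2l ?powR_ge0 //.
  have [l' ll' hl'] := act_line T u ll.
  have lu0 := lam_gt0 T u.
  have tE : t = lam u * (t / lam u) by rewrite mulrC divfK // gt_eqF.
  apply: (@le_trans _ _ (mass (r / lam u) (fun v => thicken l' (t / lam u) (act v o)))).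
    by apply: le_mass => v; rewrite act_cat {1}tE; exact: hl'.
  apply: le_trans (IH l' _ _ ll' _ _ _) _.
  - rewrite ler_pdivlMr //; apply: le_trans hn; rewrite exprSr ler_wpM2l ?exprn_ge0 ?(ltW r00) //.
    exact: (lam_cut_le c0 cP c1).
  - by rewrite divr_gt0.
  - by rewrite ler_pM2r // invr_gt0.
  rewrite ler_wpM2l ?(ltW C0) // ge0_ler_powR ?nnegrE ?(ltW k00) //.
  - by rewrite divr_ge0 ?ltW.
  - by rewrite divr_ge0 ?ltW.
  rewrite ler_pM2l // lef_pV2 ?posrE //; apply: (lam_cut_ge c0 cP c1) => //; exact: ltW.
rewrite -mulr_suml.
have -> : \sum_(u <- cut r0 | u != u0) lam u `^ D = 1 - lam u0 `^ D.
  have := sum_cut r00; rewrite (bigD1_seq u0) //=; last exact: (cut_uniq c0 cP c1).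
  by move=> <-; rewrite addrAC subrr add0r.
rewrite powR_div ?(ltW t0) ?(ltW a0) // mulrC mulrA -[leRHS]mulr1 -!mulrA.
rewrite !ler_pM2l ?powR_gt0 // mulrC ler_pdivrMr ?powR_gt0 // mul1r.
apply: le_trans hk; rewrite lerD2l lerN2 ge0_ler_powR ?nnegrE ?(ltW a0) ?(ltW (lam_gt0 _ _)) //.
apply: (lam_cut_ge c0 cP c1) => //; exact: ltW.
Qed.

(** * Consequences of the line estimate *)

Section LineBound.
Variables C k : R.
Hypotheses (C0 : 0 < C) (k0 : 0 < k).
Hypothesis hC : forall l r t, is_line l -> 0 < r -> r <= t ->
  mass r (fun w => thicken l t (act w o)) <= C * t `^ k.

Lemma mass_line_cylinder l u r t : is_line l -> 0 < r -> r <= t * lam u ->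
  mass (r / lam u) (fun v => thicken l (t * lam u) (act (u ++ v) o)) <= C * t `^ k.
Proof.
move=> ll r0 rt; have lu0 := lam_gt0 T u.
have [l' ll' hl'] := act_line T u ll.
apply: le_trans (hC ll' (divr_gt0 r0 lu0) _); last by rewrite ler_pdivrMr.
by apply: le_mass => v; rewrite act_cat mulrC; exact: hl'.
Qed.

(** [P] models a curved strip: on each cylinder of level [r'] it lies in a straight strip of
    relative width [t], whose line may depend on the cylinder. Averaging the relative bounds loses
    nothing, as the weights add up to 1. *)
Lemma mass_curve r t r' P : 0 < r' -> r' <= 1 -> 0 < t -> t <= 1 -> 0 < r -> r <= t * (c * r') ->
  (forall u, u \in cut r' -> exists2 l, is_line l &
     forall v, P (u ++ v) -> thicken l (t * lam u) (act (u ++ v) o)) ->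
  mass r P <= C * t `^ k.
Proof.
move=> r'0 r'1 t0 t1 r0 rt h.
have rr' : r <= r'.
  by apply: le_trans rt _; rewrite mulrA ler_piMl ?(ltW r'0) // mulr_ile1 // ltW.
rewrite (mass_refine _ r0 rr').
apply: le_trans (_ : \sum_(u <- cut r') lam u `^ D * (C * t `^ k) <= _); last first.
  by rewrite -mulr_suml sum_cut // mul1r.
rewrite big_seq [leRHS]big_seq; apply: ler_sum => u ur.
rewrite ler_wpM2l ?powR_ge0 //.
have [l ll hl] := h u ur.
apply: le_trans (mass_line_cylinder ll r0 _); first exact: le_mass.
apply: le_trans rt _; rewrite ler_wpM2l ?(ltW t0) //.
by apply: (lam_cut_ge c0 cP c1) => //; rewrite mulr_ile1 // ltW.
Qed.

(** For q < 1, boundedly many cylinders of level q and mass at most q^D meet the ball, and the strip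
    takes from each a fraction of order (t / q)^k. For q >= 1 the line bound suffices, because q^(D
    - k) >= 1. *)
Lemma mass_line_ball : k <= D -> exists2 C', 0 < C' &
  forall l x r t q, is_line l -> 0 < r -> r <= t -> t <= q ->
  mass r (fun w => thicken l t (act w o) /\ enorm (act w o - x) <= q) <=
    C' * t `^ k * q `^ (D - k).
Proof.
move=> kD.
have M1 : 0 <= 1 + M by rewrite addr_ge0 // ltW.
have [N N0 hN] := size_cut_near M1.
have ck0 : 0 < c `^ k by rewrite powR_gt0.
exists (N * C / c `^ k + C); first by rewrite addr_gt0 // divr_gt0 // mulr_gt0.
move=> l x r t q ll r0 rt tq; have t0 := lt_le_trans r0 rt; have q0 := lt_le_trans t0 tq.
have B0 : 0 <= N * C / c `^ k by rewrite ltW // divr_gt0 // mulr_gt0.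
have [q1|q1] := leP 1 q.
  apply: (@le_trans _ _ (C * t `^ k)).
    by apply: le_trans (hC ll r0 rt); apply: le_mass => w [].
  have : 1 <= q `^ (D - k) by rewrite -[leLHS](powRr0 q) ler_powR // subr_ge0.
  have tk := powR_gt0 k t0; move=> h; rewrite -[leLHS]mulr1.
  apply: ler_pM => //; first by rewrite mulr_ge0 // ltW.
  by rewrite ler_wpM2r ?(ltW tk) // lerDr.
have rq := le_trans rt tq.
have cq : c * q <= 1 by rewrite mulr_ile1 // ltW.
rewrite (mass_refine _ r0 rq).
apply: le_trans (mass_refine_near (Q := fun u => enorm (act u o - x) <= (1 + M) * q)
   (K := C * (t / (c * q)) `^ k) q0 _ _ _) _.
- move=> u ut nQ; apply: mass_pred0 => v [_ h]; apply: nQ.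
  apply: le_trans (enorm_triangle (act (u ++ v) o) _ _) _.
  rewrite enormB mulrDl mul1r addrC; apply: lerD => //; apply: le_trans (act_cat_near _ _) _.
  by rewrite ler_wpM2l ?(ltW M0) // (lam_cut_le c0 cP c1).
- move=> u ut _; have lu0 := lam_gt0 T u.
  apply: le_trans (_ : C * (t / lam u) `^ k <= _).
    have tE : t / lam u * lam u = t by rewrite divfK // gt_eqF.
    have := mass_line_cylinder (u := u) (t := t / lam u) ll r0; rewrite tE => /(_ rt).
    by apply: le_trans; apply: le_mass => v [].
  rewrite ler_wpM2l ?(ltW C0) // ge0_ler_powR ?nnegrE ?(ltW k0) //.
  - by rewrite divr_ge0 ?ltW.
  - by rewrite divr_ge0 ?ltW // mulr_gt0.
  rewrite ler_pM2l // lef_pV2 ?posrE ?mulr_gt0 //; exact: (lam_cut_ge c0 cP c1).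
- by rewrite mulr_ge0 ?powR_ge0 // ltW.
have -> : (t / (c * q)) `^ k = t `^ k / c `^ k / q `^ k.
  rewrite powR_div ?mulr_ge0 ?(ltW t0) ?(ltW c0) ?(ltW q0) // powRM ?(ltW c0) ?(ltW q0) //.
  by rewrite invfM mulrA.
rewrite powRB; last by rewrite (gt_eqF q0) implybT.
have -> : forall n : R, n * q `^ D * (C * (t `^ k / c `^ k / q `^ k)) =
   n * (C / c `^ k * t `^ k * (q `^ D / q `^ k)).
  by move=> n; field; rewrite (gt_eqF ck0) (gt_eqF (powR_gt0 k q0)).
have Y0 : 0 <= t `^ k * (q `^ D / q `^ k) by rewrite mulr_ge0 ?divr_ge0 ?powR_ge0.
apply: le_trans (ler_wpM2r _ (hN q x q0 cq)) _.
  by rewrite -!mulrA mulr_ge0 ?(ltW C0) // mulr_ge0 // invr_ge0 powR_ge0.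
rewrite mulrDl mulrDl -[leLHS]addr0; apply: lerD; last by rewrite -mulrA mulr_ge0 // ltW.
by rewrite -!mulrA.
Qed.

End LineBound.

End Mass.

(** * Hausdorff dimension *)

Section HausdorffGeneric.
Variable R : realType.
Implicit Types (x y : plane R) (A : set (plane R)) (r q d : R).

Lemma ediam_ge0 A : (0 <= ediam A)%E.
Proof. by apply: ereal_sup_ubound; left. Qed.

Lemma enorm_le_ediam A x y : A x -> A y -> ((enorm (x - y))%:E <= ediam A)%E.
Proof. by move=> Ax Ay; apply: ereal_sup_ubound; right; exists (x, y). Qed.

Lemma ediam_disc x r : 0 <= r -> (ediam (disc x r) <= (2 * r)%:E)%E.
Proof.
move=> r0; apply: ge_ereal_sup => _ [->|[[y z] /= [hy hz] <-]].
  by rewrite lee_fin mulr_ge0.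
rewrite lee_fin eucl_distE; apply: le_trans (enorm_triangle x _ _) _.
by rewrite [enorm (y - x)]enormB; move: hy hz; rewrite !discE; lra.
Qed.

Lemma ediam_set0 : ediam (set0 : set (plane R)) = 0%E.
Proof.
apply/eqP; rewrite eq_le ediam_ge0 andbT; apply: ge_ereal_sup => z [->//|].
by move=> [[y w] /= [hy]].
Qed.

Lemma hausdorff_premeasure_ge0 q d A : (0 <= hausdorff_premeasure q d A)%E.
Proof.
apply: le_ereal_inf_tmp => _ [U _ <-].
by apply: nneseries_ge0 => n _ _; exact: poweR_ge0.
Qed.

Lemma nneseries_le (f : nat -> \bar R) (b : \bar R) : (forall n, (0 <= f n)%E) ->
  (forall n, (\sum_(0 <= i < n) f i <= b)%E) -> (\sum_(0 <= i <oo) f i <= b)%E.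
Proof.
move=> f0 h; apply: lime_le; first exact: (is_cvg_nneseries (fun n _ _ => f0 n)).
exact: nearW.
Qed.

Lemma open_edisc x r : open [set y | enorm (y - x) < r].
Proof.
rewrite openE => y /= h; rewrite /interior; apply/nbhs_ballP.
exists ((r - enorm (y - x)) / 2); first by rewrite /= divr_gt0 // subr_gt0.
move=> z [h1 h2] /=; move: h1 h2; rewrite /ball /= => h1 h2.
apply: le_lt_trans (enorm_triangle y _ _) _; rewrite -ltrBrDr enormB.
apply: le_lt_trans (enorm_le_sum _) _; rewrite !planeE; lra.
Qed.

Lemma compact_plane_cover A (I : choiceType) (f : I -> set (plane R)) : compact A ->
  (forall i, open (f i)) -> A `<=` \bigcup_i f i ->
  exists2 F : seq I, uniq F & forall y, A y -> exists2 i, i \in F & f i y.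
Proof.
(* compact_cover is stated for pointed spaces, and R * R is not canonically one. *)
pose X : ptopologicalType := HB.pack (plane R) (isPointed.Build (plane R) (0, 0)).
move=> cA fo Af; have : @compact X A by [].
rewrite compact_cover => /(_ I setT f) [//|//|F _ AF].
by exists (finmap.enum_fset F); [exact: finmap.fset_uniq|move=> y /AF[i iF ?]; exists i].
Qed.

Lemma powRD_le (a b q : R) : 0 <= q -> 0 <= a -> 0 <= b ->
  (a + b) `^ q <= 2 `^ q * (a `^ q + b `^ q).
Proof.
move=> q0 a0 b0; wlog ab : a b a0 b0 / a <= b => [hw|].
  have [/hw|/ltW/hw] := leP a b; first exact.
  by rewrite [b + a]addrC [b `^ q + _]addrC; apply.
apply: (@le_trans _ _ ((2 * b) `^ q)).
  by rewrite ge0_ler_powR ?nnegrE ?addr_ge0 ?mulr_ge0 //; lra.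
by rewrite powRM // ler_wpM2l ?powR_ge0 // lerDr powR_ge0.
Qed.

Lemma sum_sub_iota (F : seq nat) (f : nat -> R) : uniq F -> (forall i, 0 <= f i) ->
  exists n, \sum_(i <- F) f i <= \sum_(0 <= i < n) f i.
Proof.
move=> uF f0; exists (\max_(i <- F) i).+1.
have -> : \sum_(i <- F) f i = \sum_(i <- [seq i <- iota 0 (\max_(i <- F) i).+1 | i \in F]) f i.
  apply: perm_big; apply: uniq_perm => //; first by rewrite filter_uniq // iota_uniq.
  move=> i; rewrite mem_filter mem_iota add0n leq0n /= ltnS.
  by case iF: (i \in F) => //=; apply/esym; exact: (@leq_bigmax_seq _ F xpredT id i iF).
rewrite big_filter big_mkcond /index_iota subn0; apply: ler_sum => i _.
by case: ifP.
Qed.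

Lemma sum_half_le (eps : R) n : 0 <= eps ->
  \sum_(0 <= i < n) eps / 2 ^+ i.+1 <= eps.
Proof.
move=> e0; suff -> : \sum_(0 <= i < n) eps / 2 ^+ i.+1 = eps - eps / 2 ^+ n.
  by rewrite gerBl divr_ge0 // exprn_ge0.
elim: n => [|n IH]; first by rewrite big_geq // expr0 divr1 subrr.
rewrite big_nat_recr //= IH exprS; field.
by rewrite expf_neq0 // pnatr_eq0.
Qed.

End HausdorffGeneric.

Section Dimension.
Variables (R : realType) (s : nat) (T : 'I_s -> similitude R).
Variables (c D : R).
Hypotheses (c0 : 0 < c) (c1 : c < 1).
Hypothesis cP : forall i, c <= sim_ratio (T i) <= 1 - c.
Hypotheses (D0 : 0 <= D) (hD : \sum_i sim_ratio (T i) `^ D = 1).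
Variables (O : set (plane R)) (o : plane R) (e M : R).
Hypothesis TO : \bigcup_i (sim_apply (T i) @` O) `<=` O.
Hypothesis TOd : trivIset [set: 'I_s] (fun i => sim_apply (T i) @` O).
Hypothesis e0 : 0 < e.
Hypothesis oO : disc o e `<=` O.
Hypothesis M0 : 0 < M.
Hypothesis oM : forall w, enorm (act T w o - o) <= M.
Variable J : set (plane R).
Hypothesis J0 : J !=set0.
Hypothesis J_cover : forall r y, 0 < r -> J y ->
  exists2 u, u \in cut T c r & enorm (y - act T u o) <= M * r.
Hypothesis J_compact : compact J.
Hypothesis J_act : forall w y, J y -> J (act T w y).
Hypothesis oJ : forall y, J y -> enorm (o - y) <= M.

Local Notation cut := (cut T c).
Local Notation act := (act T).

Lemma hausdorff_premeasure_cut_le q d r : 0 < q -> 0 < r -> 2 * (M * r) <= d ->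
  (hausdorff_premeasure q d J <= ((size (cut r))%:R * (2 * (M * r)) `^ q)%:E)%E.
Proof.
move=> q0 r0 rd; have Mr0 : 0 < M * r by rewrite mulr_gt0.
(* The cover is continued by empty sets; their diameter 0 contributes nothing because [0 < q]. *)
pose U i := if (i < size (cut r))%N then disc (act (nth [::] (cut r) i) o) (M * r) else set0.
have dU i : (ediam (U i) <= (2 * (M * r))%:E)%E.
  rewrite /U; case: ifP => _; first exact: ediam_disc (ltW Mr0).
  by rewrite ediam_set0 lee_fin mulr_ge0 // ltW.
apply: (@le_trans _ _ (\sum_(0 <= i <oo) poweR (ediam (U i)) q)%E).
  apply: ereal_inf_lbound; exists U => //; split.
    move=> y Jy; have [u ur yu] := J_cover r0 Jy.
    exists (index u (cut r)) => //; rewrite /U index_mem ur nth_index //.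
    by rewrite discE enormB.
  by move=> i; apply: le_trans (dU i) _; rewrite lee_fin.
apply: nneseries_le => [n|n]; first exact: poweR_ge0.
apply: (@le_trans _ _ (\sum_(0 <= i < n | (i < size (cut r))%N) ((2 * (M * r)) `^ q)%:E)%E).
  rewrite [leRHS]big_mkcond /=; apply: lee_sum => i _; rewrite /U.
  have := dU i; rewrite /U; case: ifP => _ h; last by rewrite ediam_set0 poweR0r // gt_eqF.
  rewrite -poweR_EFin; apply: gt0_ler_poweR => //; first exact: ltW.
  - by rewrite in_itv /= ediam_ge0 leey.
  - by rewrite in_itv /= lee_fin leey andbT mulr_ge0 // ltW.
rewrite sumEFin lee_fin big_const_seq iter_addr_0 -[leLHS]mulr_natl.
rewrite ler_wpM2r ?powR_ge0 // ler_nat -size_filter.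
rewrite -[leqRHS](size_iota 0); apply: uniq_leq_size.
  by rewrite filter_uniq // iota_uniq.
by move=> i; rewrite mem_filter mem_iota add0n => /andP[].
Qed.

Lemma hausdorff_measure0 q : D < q -> hausdorff_measure q J = 0%E.
Proof.
move=> Dq; have q0 : 0 < q by apply: le_lt_trans Dq.
suff H d : 0 < d -> hausdorff_premeasure q d J = 0%E.
  apply/eqP; rewrite eq_le; apply/andP; split.
    by apply: ge_ereal_sup => _ [d /= d0 <-]; rewrite H.
  by apply: ereal_sup_ubound; exists 1; [exact: ltr01|exact: H].
move=> d0; apply/eqP; rewrite eq_le hausdorff_premeasure_ge0 andbT.
apply/lee_addgt0Pr => eps eps0; rewrite add0e.
pose K := (c `^ D)^-1 * (2 * M) `^ q.
have cD0 : 0 < c `^ D by rewrite powR_gt0.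
have K0 : 0 < K by rewrite mulr_gt0 ?invr_gt0 // powR_gt0 // mulr_gt0.
have qD0 : 0 < q - D by rewrite subr_gt0.
(* There are at most (c r)^(-D) discs of diameter 2 M r, so the covering sum is at most K r^(q - D).
   The second bound keeps diameters below [d], the third makes the sum at most [eps]. *)
pose r := Num.min 1 (Num.min (d / (2 * M)) ((eps / K) `^ (q - D)^-1)).
have r0 : 0 < r by rewrite !lt_min ltr01 divr_gt0 ?mulr_gt0 //= powR_gt0 // divr_gt0.
have r1 : r <= 1 by rewrite ge_min lexx.
have rd : r <= d / (2 * M) by rewrite !ge_min lexx orbT.
have re : r <= (eps / K) `^ (q - D)^-1 by rewrite !ge_min lexx !orbT.
apply: le_trans (hausdorff_premeasure_cut_le q0 r0 _) _.
  by rewrite mulrA mulrC -ler_pdivlMr // mulr_gt0.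
rewrite lee_fin.
have cr : c * r <= 1 by rewrite mulr_ile1 // ltW.
have := le_size_mass c0 c1 cP D0 (fun=> True) r0 cr.
have -> : [seq w <- cut r | `[< True >]] = cut r.
  by rewrite asboolT // filter_predT.
move=> /le_trans /(_ (mass_le1 c0 c1 cP hD _ r0)) hs.
rewrite powRM ?(ltW c0) ?(ltW r0) // mulrA in hs.
have rD0 : 0 < r `^ D by rewrite powR_gt0.
have {}hs : (size (cut r))%:R <= (c `^ D)^-1 / r `^ D.
  by rewrite ler_pdivlMr // -[leRHS]mul1r ler_pdivlMr // mulrAC.
apply: le_trans (ler_wpM2r (powR_ge0 _ _) hs) _.
have -> : (2 * (M * r)) `^ q = (2 * M) `^ q * r `^ q.
  by rewrite mulrA powRM // ?mulr_ge0 // ltW.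
have -> : (c `^ D)^-1 / r `^ D * ((2 * M) `^ q * r `^ q) = K * r `^ (q - D).
  by rewrite powRB ?(gt_eqF r0) ?implybT // /K; field; rewrite (gt_eqF cD0) (gt_eqF rD0).
rewrite mulrC -ler_pdivlMr //.
have -> : eps / K = ((eps / K) `^ (q - D)^-1) `^ (q - D).
  by rewrite -powRrM mulVf ?gt_eqF // powRr1 // divr_ge0 // ltW.
by rewrite ge0_ler_powR ?nnegrE ?powR_ge0 ?(ltW r0) // ltW.
Qed.

(* Enlarge the covering sets to open sets, extract a finite subcover and compare
   masses at a level below all the diameters of the subcover. *)
Lemma hausdorff_measure_neq0 q : 0 < q -> hausdorff_measure q J = 0%E -> D <= q.
Proof.
move=> q0 H0; rewrite leNgt; apply/negP => qD.
have [N N0 hN] := mass_ball c0 c1 cP D0 hD TO TOd e0 oO M0 oM.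
have M1 : 0 < 1 + M by rewrite addr_gt0.
pose K := (N + 1) * (1 + M) `^ q * 2 `^ q.
have K0 : 0 < K by rewrite !mulr_gt0 // ?powR_gt0 // addr_gt0.
(* The total mass will be at most [K * (eps + eps)], that is 1/2, against its value 1. *)
pose eps := (4 * K)^-1.
have eps0 : 0 < eps by rewrite invr_gt0 mulr_gt0.
have : (hausdorff_premeasure q 1 J < eps%:E)%E.
  apply: (@le_lt_trans _ _ 0%E); last by rewrite lte_fin.
  by rewrite -H0; apply: ereal_sup_ubound; exists 1 => //=; exact: ltr01.
move=> /ereal_inf_lt [_ [U [JU dU] <-]] hsum.
pose d i := fine (ediam (U i)).
have dE i : ediam (U i) = (d i)%:E.
  rewrite /d fineK // fin_numElt (lt_le_trans _ (ediam_ge0 _)) ?ltNyr //.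
  exact: le_lt_trans (dU i) (ltry _).
have d0 i : 0 <= d i by rewrite -lee_fin -dE ediam_ge0.
(* The enlargements have q-th powers of sum at most [eps]; being positive, they also give a positive
   radius to sets of diameter 0. *)
pose h i := (eps / 2 ^+ i.+1) `^ q^-1.
have hp i : 0 < eps / 2 ^+ i.+1 by rewrite divr_gt0 // exprn_gt0.
have h0 i : 0 < h i by rewrite powR_gt0.
have hq i : h i `^ q = eps / 2 ^+ i.+1.
  by rewrite /h -powRrM mulVf ?gt_eqF // powRr1 // ltW.
pose G i := \bigcup_(x in U i) [set y | enorm (y - x) < h i].
have Gopen i : open (G i) by apply: bigcup_open => x _; exact: open_edisc.
have [F uF JF] : exists2 F : seq nat, uniq F & forall y, J y -> exists2 i, i \in F & G i y.
  apply: (compact_plane_cover J_compact Gopen).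
  by move=> y /JU [i _ Uy]; exists i => //; exists y => //=; rewrite subrr enorm0.
pose rho i := d i + h i.
have rho0 i : 0 < rho i by rewrite ltr_wpDl.
pose x i := xget o (U i).
have Gx i y : G i y -> enorm (y - x i) <= rho i.
  move=> [z Uz /= zy]; apply: le_trans (enorm_triangle z _ _) _.
  rewrite addrC; apply: lerD; last exact: ltW.
  rewrite -lee_fin -dE; apply: enorm_le_ediam => //.
  by rewrite /x; case: xgetP => [?|/(_ z)].
have [r r0 hr] : exists2 r, 0 < r & forall i, i \in F -> r <= rho i.
  exists (\big[Num.min/1]_(i <- F) rho i).
    by apply: lt_bigmin => // i _; exact: rho0.
  by move=> i iF; apply: (@bigmin_inf_seq _ _ _ _ _ i); rewrite ?lexx.
have [y0 Jy0] := J0.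
(* For t <= 1 the assumption q < D gives t^D <= t^q; for larger t the mass is at most 1. *)
have hNq t z : 0 < t -> r <= t -> mass T c D r (fun w => enorm (act w o - z) <= t) <= (N + 1) * t `^ q.
  move=> t0 rt; have [t1|t1] := leP t 1.
    apply: le_trans (hN r t z r0 rt) _; apply: ler_pM; rewrite ?(ltW N0) ?powR_ge0 ?lerDl //.
    by rewrite ger_powR ?(ltW qD) // t0 t1.
  apply: le_trans (mass_le1 c0 c1 cP hD _ r0) _.
  have : 1 <= t `^ q by rewrite -[leLHS](powRr0 t) ler_powR // ltW.
  by move=> ht; nra.
(* Each [act w y0] lies in J, hence in some [G i] of the subcover, and [act w o] is within
   [M * r <= M * rho i] of it. *)
have : 1 <= \sum_(i <- F) mass T c D r (fun w => enorm (act w o - x i) <= (1 + M) * rho i).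
  apply: le_trans (mass_exists _ _ _ _ _ _).
  rewrite -[leLHS](sum_cut c0 c1 cP hD r0) /mass [leRHS]big_mkcond big_seq [leRHS]big_seq.
  apply: ler_sum => w wr; rewrite asboolT //.
  have [i iF Gi] := JF _ (J_act w Jy0); exists i => //.
  apply: le_trans (enorm_triangle (act w y0) _ _) _.
  rewrite mulrDl mul1r addrC; apply: lerD; first exact: Gx.
  rewrite act_dist mulrC; apply: ler_pM => //; [exact: enorm_ge0|exact: ltW (lam_gt0 _ _)|exact: oJ|].
  exact: le_trans (lam_cut_le c0 cP c1 r0 wr) (hr i iF).
apply/negP; rewrite -ltNge.
have [n hn] := @sum_sub_iota R F (fun i => d i `^ q + h i `^ q) uF
  (fun i => addr_ge0 (powR_ge0 _ _) (powR_ge0 _ _)).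
apply: (@le_lt_trans _ _ (\sum_(i <- F) K * (d i `^ q + h i `^ q))).
  rewrite big_seq [leRHS]big_seq; apply: ler_sum => i iF.
  apply: le_trans (hNq _ _ _ _) _.
  - by rewrite mulr_gt0.
  - by apply: le_trans (hr i iF) _; rewrite ler_peMl ?(ltW (rho0 i)) // lerDl ltW.
  have -> : K * (d i `^ q + h i `^ q) =
    (N + 1) * (1 + M) `^ q * (2 `^ q * (d i `^ q + h i `^ q)) by rewrite /K !mulrA.
  rewrite powRM ?(ltW M1) ?(ltW (rho0 i)) // mulrA.
  rewrite ler_wpM2l ?mulr_ge0 ?powR_ge0 ?addr_ge0 ?(ltW N0) //.
  exact: powRD_le (ltW q0) (d0 i) (ltW (h0 i)).
rewrite -mulr_sumr; apply: (@le_lt_trans _ _ (K * (eps + eps))).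
  rewrite ler_pM2l //; apply: le_trans hn _; rewrite big_split; apply: lerD.
    rewrite -lee_fin -sumEFin.
    under eq_bigr do rewrite -poweR_EFin -dE.
    apply: le_trans (ltW hsum).
    by apply: nneseries_lim_ge => m _ _; exact: poweR_ge0.
  under eq_bigr do rewrite hq.
  exact: sum_half_le (ltW eps0).
rewrite /eps.
have -> : K * ((4 * K)^-1 + (4 * K)^-1) = 2^-1 by field; rewrite gt_eqF.
by rewrite invf_lt1 ?ltr0n // ltr1n.
Qed.

Lemma hausdorff_dimE : hausdorff_dim J = D%:E.
Proof.
apply/eqP; rewrite eq_le; apply/andP; split.
  apply/lee_addgt0Pr => eps eps0; rewrite -EFinD; apply: ereal_inf_lbound.
  exists (D + eps) => //; split; first by rewrite ltr_wpDl.
  by apply: hausdorff_measure0; rewrite ltrDl.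
apply: le_ereal_inf_tmp => _ [q [q0 hq] <-]; rewrite lee_fin.
exact: hausdorff_measure_neq0.
Qed.

End Dimension.

(** * Continuously differentiable maps *)

Section C1.
Variable R : realType.
Lemma diff_comp_fst (f : plane R -> plane R) x : differentiable f x ->
  differentiable (fst \o f) x /\ 'd (fst \o f) x = (fst \o 'd f x) :> (plane R -> R).
Proof.
move=> df.
have cf : continuous (fst : plane R -> R) by move=> z; exact: cvg_fst.
have lf z : differentiable (fst : plane R -> R) z by exact: linear_differentiable.
by split; [exact: differentiable_comp|rewrite diff_comp // diff_lin].
Qed.

Lemma diff_comp_snd (f : plane R -> plane R) x : differentiable f x ->
  differentiable (snd \o f) x /\ 'd (snd \o f) x = (snd \o 'd f x) :> (plane R -> R).
Proof.
move=> df.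
have cf : continuous (snd : plane R -> R) by move=> z; exact: cvg_snd.
have lf z : differentiable (snd : plane R -> R) z by exact: linear_differentiable.
by split; [exact: differentiable_comp|rewrite diff_comp // diff_lin].
Qed.

Lemma segment_deriv (g : plane R -> R) (x v : plane R) (t : R) :
  differentiable g (x + t *: v) ->
  is_derive t 1 (fun t => g (x + t *: v)) ('d g (x + t *: v) v).
Proof.
move=> dg; have dd : derivable g (x + t *: v) v by exact: diff_derivable.
have E : (fun h : R => h^-1 *: (((fun t => g (x + t *: v)) \o shift t) (h *: (1 : R)) - g (x + t *: v))) =
  (fun h : R => h^-1 *: ((g \o shift (x + t *: v)) (h *: v) - g (x + t *: v))).
  apply/funext => h /=; congr (_ *: (g _ - _)).
  apply: plane_ext; rewrite !planeE [h *: 1]mulr1; ring.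
apply: DeriveDef; first by rewrite /derivable E.
have -> : 'd g (x + t *: v) v = 'D_v g (x + t *: v) by rewrite deriveE.
exact: (congr1 (fun F : R -> R => lim (F @ 0^')) E).
Qed.

Lemma mean_value_fun (g : plane R -> R) (x v : plane R) :
  (forall z, differentiable g z) ->
  exists2 t, 0 <= t <= 1 & g (x + v) - g x = 'd g (x + t *: v) v.
Proof.
move=> dg.
have [|||t] := @MVT_segment R (fun t => g (x + t *: v)) (fun t => 'd g (x + t *: v) v) 0 1.
- exact: ler01.
- by move=> t _; exact: segment_deriv.
- apply: continuous_subspaceT => t; apply: differentiable_continuous.
  by apply/derivable1_diffP; have [] := segment_deriv (dg (x + t *: v)).
rewrite in_itv /= scale0r addr0 scale1r subr0 mulr1 => ht E.
by exists t.
Qed.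

(** The mean value theorem holds only coordinatewise, with a separate intermediate point for each;
    [enorm_le_max] recombines the coordinates at the cost of a factor 2. *)
Lemma mean_value1 (f : plane R -> plane R) (x y : plane R) :
  (forall z, differentiable f z) ->
  exists2 t, 0 <= t <= 1 & (f y - f x).1 = ('d f (x + t *: (y - x)) (y - x)).1.
Proof.
move=> df; have [t ht E] := mean_value_fun x (y - x) (fun z => (diff_comp_fst (df z)).1).
by exists t => //; move: E; rewrite [x + (y - x)]addrC subrK (diff_comp_fst (df _)).2.
Qed.

Lemma mean_value2 (f : plane R -> plane R) (x y : plane R) :
  (forall z, differentiable f z) ->
  exists2 t, 0 <= t <= 1 & (f y - f x).2 = ('d f (x + t *: (y - x)) (y - x)).2.
Proof.
move=> df; have [t ht E] := mean_value_fun x (y - x) (fun z => (diff_comp_snd (df z)).1).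
by exists t => //; move: E; rewrite [x + (y - x)]addrC subrK (diff_comp_snd (df _)).2.
Qed.

Lemma compact_box (B : R) : compact (box (- B) B (- B) B).
Proof. by apply: compact_setX; exact: segment_compact. Qed.

Lemma enorm_le_box (B : R) x : enorm x <= B -> box (- B) B (- B) B x.
Proof.
move=> xB; split => /=; rewrite in_itv /= -ler_norml.
  exact: le_trans (norm1_le_enorm _) xB.
exact: le_trans (norm2_le_enorm _) xB.
Qed.

Lemma continuous_bound (g : plane R -> R) (B : R) : continuous g ->
  exists2 K, 0 < K & forall x, enorm x <= B -> `|g x| <= K.
Proof.
move=> cg; have cK : compact (g @` box (- B) B (- B) B).
  apply: continuous_compact; [exact: continuous_subspaceT|exact: compact_box].
have [K0 [_ hK]] := compact_bounded cK.
exists (Num.max K0 0 + 1); first by rewrite ltr_wpDl // le_max lexx orbT.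
move=> x xB; apply: (hK (Num.max K0 0 + 1)).
  by rewrite ltr_pwDr // le_max lexx.
by exists x => //; exact: enorm_le_box.
Qed.

(** A Lebesgue number argument. Only [x] is confined to the bounded region, so uniform continuity on
    the box would not cover [y]. The radius [2 * d] leaves one [d] for the distance from a centre to
    [x] and one for that from [x] to [y]. *)
Lemma continuous_unif (g : plane R -> R) (B eta : R) : continuous g -> 0 < eta ->
  exists2 d, 0 < d & forall x y, enorm x <= B -> enorm (x - y) <= d ->
    `|g x - g y| <= eta.
Proof.
move=> cg eta0.
have h x : exists d, 0 < d /\ forall y, enorm (y - x) < 2 * d -> `|g x - g y| <= eta / 2.
  have /cvgrPdist_le /(_ (eta / 2)) := cg x.
  rewrite divr_gt0 // => /(_ isT) /nbhs_ballP [d /= d0 hd].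
  exists (d / 2); split; first by rewrite divr_gt0.
  move=> y; rewrite mulrC divfK ?pnatr_eq0 // => yx; apply: hd.
  split; rewrite /ball /= distrC; apply: le_lt_trans yx.
    by have := norm1_le_enorm (y - x).
  by have := norm2_le_enorm (y - x).
have [rho hrho] := choice h.
have [|F uF hF] := @compact_plane_cover R _ _ (fun x => [set y | enorm (y - x) < rho x])
  (@compact_box B) (fun x => @open_edisc R x (rho x)).
  move=> y _; exists y => //=; rewrite subrr enorm0; exact: (hrho y).1.
exists (\big[Num.min/1]_(i <- F) rho i).
  by apply: lt_bigmin => // i _; exact: (hrho i).1.
move=> x y xB xy; have [i iF /= xi] := hF x (enorm_le_box xB).
have di : \big[Num.min/1]_(i <- F) rho i <= rho i.
  by apply: (@bigmin_inf_seq _ _ _ _ _ i); rewrite ?lexx.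
have h1 : `|g i - g x| <= eta / 2.
  by apply: (hrho i).2; apply: lt_le_trans xi _; have := (hrho i).1; lra.
have h2 : `|g i - g y| <= eta / 2.
  apply: (hrho i).2; apply: le_lt_trans (enorm_triangle x _ _) _.
  by rewrite enormB; have := le_trans xy di; lra.
have -> : g x - g y = (g i - g y) - (g i - g x) by ring.
by apply: le_trans (ler_normB _ _) _; lra.
Qed.

Variable f : plane R -> plane R.
Hypothesis fC1 : C1_map f.

Let df : forall x, differentiable f x := fC1.1.

Let entry_continuous (v : plane R) :
  continuous (fun x => ('d f x v).1) /\ continuous (fun x => ('d f x v).2).
Proof.
split=> x; apply: continuous_comp (fC1.2 v x) _; [exact: cvg_fst|exact: cvg_snd].
Qed.

Let basis_expand (v : plane R) : v = v.1 *: (1, 0) + v.2 *: (0, 1) :> plane R.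
Proof. by apply: plane_ext; rewrite !planeE /=; ring. Qed.

Let diffE x v : 'd f x v = v.1 *: 'd f x (1, 0) + v.2 *: 'd f x (0, 1).
Proof. by rewrite {1}(basis_expand v) linearD !linearZ. Qed.

(** [C1_map] gives continuity for each fixed direction; expanding [v] in the standard basis leaves
    four scalar functions and makes the bound uniform in [v]. *)
Lemma C1_diff_bound B : exists2 K, 0 < K &
  forall x v, enorm x <= B -> enorm ('d f x v) <= K * enorm v.
Proof.
have [c11 c12] := entry_continuous (1, 0); have [c21 c22] := entry_continuous (0, 1).
have [K1 k1 h1] := continuous_bound B c11; have [K2 k2 h2] := continuous_bound B c12.
have [K3 k3 h3] := continuous_bound B c21; have [K4 k4 h4] := continuous_bound B c22.
exists (K1 + K2 + K3 + K4); first by lra.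
move=> x v xB; rewrite diffE; apply: le_trans (enormD _ _) _; rewrite !enormZ.
have e1 := le_trans (enorm_le_sum ('d f x (1, 0))) (lerD (h1 x xB) (h2 x xB)).
have e2 := le_trans (enorm_le_sum ('d f x (0, 1))) (lerD (h3 x xB) (h4 x xB)).
have n1 := norm1_le_enorm v; have n2 := norm2_le_enorm v.
have := ler_pM (normr_ge0 _) (enorm_ge0 _) n1 e1.
have := ler_pM (normr_ge0 _) (enorm_ge0 _) n2 e2.
by lra.
Qed.

Lemma C1_diff_unif B eta : 0 < eta -> exists2 d, 0 < d &
  forall x y v, enorm x <= B -> enorm (x - y) <= d ->
    enorm ('d f x v - 'd f y v) <= eta * enorm v.
Proof.
move=> eta0; have eta4 : 0 < eta / 4 by rewrite divr_gt0.
have [c11 c12] := entry_continuous (1, 0); have [c21 c22] := entry_continuous (0, 1).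
have [d1 k1 h1] := continuous_unif B c11 eta4; have [d2 k2 h2] := continuous_unif B c12 eta4.
have [d3 k3 h3] := continuous_unif B c21 eta4; have [d4 k4 h4] := continuous_unif B c22 eta4.
exists (Num.min (Num.min d1 d2) (Num.min d3 d4)); first by rewrite !lt_min k1 k2 k3.
move=> x y v xB; rewrite !le_min => /andP[/andP[l1 l2] /andP[l3 l4]].
have -> : 'd f x v - 'd f y v =
   v.1 *: ('d f x (1, 0) - 'd f y (1, 0)) + v.2 *: ('d f x (0, 1) - 'd f y (0, 1)).
  rewrite [LHS](congr2 (fun a b => a - b) (diffE x v) (diffE y v)).
  by rewrite !scalerBr opprD addrACA.
apply: le_trans (enormD _ _) _; rewrite !enormZ.
have e1 := le_trans (enorm_le_sum ('d f x (1, 0) - 'd f y (1, 0)))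
  (lerD (h1 x y xB l1) (h2 x y xB l2)).
have e2 := le_trans (enorm_le_sum ('d f x (0, 1) - 'd f y (0, 1)))
  (lerD (h3 x y xB l3) (h4 x y xB l4)).
have n1 := norm1_le_enorm v; have n2 := norm2_le_enorm v.
have := ler_pM (normr_ge0 _) (enorm_ge0 _) n1 e1.
have := ler_pM (normr_ge0 _) (enorm_ge0 _) n2 e2.
by lra.
Qed.

Lemma C1_lipschitz B : exists2 L, 0 < L &
  forall x y, enorm x <= B -> enorm y <= B -> enorm (f y - f x) <= L * enorm (y - x).
Proof.
have [K K0 hK] := C1_diff_bound B; exists (2 * K); first by lra.
move=> x y xB yB.
have seg (t : R) : 0 <= t <= 1 -> enorm (x + t *: (y - x)) <= B.
  move=> /andP[t0 t1]; have -> : x + t *: (y - x) = (1 - t) *: x + t *: y.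
    by apply: plane_ext; rewrite !planeE; ring.
  apply: le_trans (enormD _ _) _; rewrite !enormZ !ger0_norm ?subr_ge0 //.
  by have := enorm_ge0 x; have := enorm_ge0 y; nra.
rewrite -mulrA; apply: enorm_le_max.
  have [t ht ->] := mean_value1 x y df.
  exact: le_trans (norm1_le_enorm _) (hK _ _ (seg t ht)).
have [t ht ->] := mean_value2 x y df.
exact: le_trans (norm2_le_enorm _) (hK _ _ (seg t ht)).
Qed.

Let sub_fst_congr (u a b : plane R) : u.1 = b.1 -> (u - a).1 = - (a - b).1.
Proof. by move=> e; rewrite !planeE e opprB. Qed.

Let sub_snd_congr (u a b : plane R) : u.2 = b.2 -> (u - a).2 = - (a - b).2.
Proof. by move=> e; rewrite !planeE e opprB. Qed.

Lemma C1_expand B eta : 0 < eta -> exists2 d, 0 < d &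
  forall x y, enorm x <= B -> enorm (y - x) <= d ->
    enorm (f y - f x - 'd f x (y - x)) <= eta * enorm (y - x).
Proof.
move=> eta0; have [d d0 hd] := C1_diff_unif B (divr_gt0 eta0 (ltr0Sn _ 1)).
exists d => // x y xB xy.
have seg (t : R) : 0 <= t <= 1 -> enorm (x - (x + t *: (y - x))) <= d.
  move=> /andP[t0 t1]; rewrite opprD addrA subrr sub0r enormN enormZ ger0_norm //.
  by apply: le_trans xy; rewrite ler_piMl ?enorm_ge0.
have -> : eta * enorm (y - x) = 2 * (eta / 2 * enorm (y - x)) by field.
apply: enorm_le_max.
  have [t ht e] := mean_value1 x y df.
  have -> : (f y - f x - 'd f x (y - x)).1 =
      - ('d f x (y - x) - 'd f (x + t *: (y - x)) (y - x)).1.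
    exact: sub_fst_congr e.
  rewrite normrN.
  exact: le_trans (norm1_le_enorm _) (hd _ _ _ xB (seg t ht)).
have [t ht e] := mean_value2 x y df.
have -> : (f y - f x - 'd f x (y - x)).2 =
    - ('d f x (y - x) - 'd f (x + t *: (y - x)) (y - x)).2.
  exact: sub_snd_congr e.
rewrite normrN.
exact: le_trans (norm2_le_enorm _) (hd _ _ _ xB (seg t ht)).
Qed.

End C1.

(** * Strips and distortion *)

Section Strip.
Variable R : realType.
Implicit Types (x y : plane R) (r t : R) (l : set (plane R)).

Lemma strip_rectangle l x r t : is_line l ->
  exists2 Q, is_rectangle (2 * r) (2 * t) Q & thicken l r `&` disc x t `<=` Q.
Proof.
move=> [p [v0 [v00 lE]]]; have nv := enorm_gt0 v00.
pose v := (enorm v0)^-1 *: v0; pose n : plane R := (v.2, - v.1).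
have vv : dot v v = 1.
  have -> : dot v v = (enorm v0)^-1 ^+ 2 * dot v0 v0 by rewrite /dot !planeE; ring.
  by rewrite -enorm_sqr exprVn mulVf // sqrf_eq0 gt_eqF.
have nn : dot n n = 1 by rewrite -vv /dot /=; ring.
have nv0 : dot n v = 0 by rewrite /dot /=; ring.
have ev : enorm v = 1 by rewrite /enorm vv sqrtr1.
have cv y : cross y v = (enorm v0)^-1 * cross y v0 by rewrite /cross /v !planeE; ring.
have [n1 n2] : n.1 = v.2 /\ n.2 = - v.1 by [].
clearbody v n.
(* The corner of the rectangle with sides along the normal [n] and the direction [v] of the line. *)
pose q := (dot p n - r) *: n + (dot x v - t) *: v.
have qn : dot q n = dot p n - r.
  transitivity ((dot p n - r) * dot n n + (dot x v - t) * dot n v).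
    by rewrite /q /dot !planeE; ring.
  by rewrite nn nv0; ring.
have qv : dot q v = dot x v - t.
  transitivity ((dot p n - r) * dot n v + (dot x v - t) * dot v v).
    by rewrite /q /dot !planeE; ring.
  by rewrite vv nv0; ring.
exists [set q + a.1 *: n + a.2 *: v | a in `[0, 2 * r] `*` `[0, 2 * t]].
  by exists q, n, v; split.
move=> y []; rewrite rectangleE // lE => /(thicken_line _ _ _ v00) h1; rewrite discE => h2.
have dn : dot (y - q) n = cross (y - p) v + r.
  transitivity (dot (y - p) n + dot p n - dot q n); first by rewrite /dot !planeE; ring.
  by rewrite qn /dot /cross n1 n2; ring.
have dv : dot (y - q) v = dot (y - x) v + t.
  transitivity (dot (y - x) v + dot x v - dot q v); first by rewrite /dot !planeE; ring.
  by rewrite qv; ring.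
have c1 : `|cross (y - p) v| <= r.
  by rewrite cv normrM gtr0_norm ?invr_gt0 // mulrC ler_pdivrMr.
have c2 : `|dot (y - x) v| <= t.
  apply: le_trans h2; rewrite enormB -[leRHS]mulr1 -ev.
  rewrite -[X in X <= _](_ : `|cross (y - x) (- n)| = _); last by congr `|_|; rewrite /cross /dot !planeE n1 n2; ring.
  apply: le_trans (cross_le _ _) _; rewrite enormN.
  by rewrite ev /enorm nn sqrtr1.
move: c1 c2; rewrite !ler_norml => /andP[? ?] /andP[? ?].
by rewrite /= dn dv; split; lra.
Qed.

Lemma area_strip l x r t A : is_line l -> 0 < r -> r <= t -> bmeas A ->
  A `<=` thicken l r `&` disc x t -> (area A <= (128 * r * t)%:E)%E.
Proof.
move=> ll r0 rt mA AS; have [Q hQ sQ] := strip_rectangle x r t ll.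
apply: le_trans (area_sub_rectangle _ _ hQ mA (subset_trans AS sQ)) _.
- by rewrite mulr_gt0.
- by rewrite ler_pM2l.
- by rewrite lee_fin; nra.
Qed.

Lemma rectangle_sub_strip r1 r2 Q : 0 < r1 -> r1 <= r2 -> is_rectangle r1 r2 Q ->
  exists l x, [/\ is_line l, Q `<=` thicken l r1 & Q `<=` disc x (2 * r2)].
Proof.
move=> r10 r12 [p [u [v [uu vv uv ->]]]].
have eu : enorm u = 1 by rewrite /enorm uu sqrtr1.
have ev : enorm v = 1 by rewrite /enorm vv sqrtr1.
have v0 : v != 0.
  by apply/negP => /eqP h; move: ev; rewrite h enorm0 => /eqP; rewrite eq_sym oner_eq0.
exists [set p + t *: v | t in [set: R]], p; split; first by exists p, v.
  move=> y [[a b] /= [/=]]; rewrite !in_itv /= => /andP[a0 a1] _ <-.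
  apply/thickenP; exists (p + b *: v); first by exists b.
  have -> : p + b *: v - (p + a *: u + b *: v) = (- a) *: u.
    by apply: plane_ext; rewrite !planeE; ring.
  by rewrite enormZ eu mulr1 normrN ger0_norm.
move=> y [[a b] /= [/=]]; rewrite !in_itv /= => /andP[a0 a1] /andP[b0 b1] <-.
rewrite discE; have -> : p - (p + a *: u + b *: v) = (- a) *: u + (- b) *: v.
  by apply: plane_ext; rewrite !planeE; ring.
apply: le_trans (enormD _ _) _; rewrite !enormZ eu ev !mulr1 !normrN !ger0_norm //.
by lra.
Qed.

End Strip.

(** * Distortion of cylinders by a diffeomorphism *)

Section Distortion.
Variables (R : realType) (s : nat) (T : 'I_s -> similitude R).
Variables (o : plane R) (M : R).
Hypothesis M0 : 0 < M.
Hypothesis oM : forall w, enorm (act T w o - o) <= M.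
Variables phi psi : plane R -> plane R.
Hypotheses (phiK : cancel phi psi) (psiK : cancel psi phi).
Hypotheses (phiC1 : C1_map phi) (psiC1 : C1_map psi).

Local Notation act := (act T).
Local Notation lam := (lam T).

(* The last clause follows from the expansion of psi at phi x0, x0 = act u o: the
   line l' is the image of l by the affine approximation of psi, or any line
   through it when that image is a point. *)
Lemma distortion : exists L B : R, [/\ 1 <= L, 0 < B,
  [/\ forall w x, enorm (x - act w o) <= M + 1 ->
        enorm (phi x - phi (act w o)) <= L * enorm (x - act w o),
      forall w y, enorm (y - phi (act w o)) <= 1 ->
        enorm (psi y - act w o) <= L * enorm (y - phi (act w o)),
      forall u v, enorm (act u o - act v o) <= L * enorm (phi (act u o) - phi (act v o)) &
      forall w, enorm (phi (act w o)) <= B] &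
  forall eta, 0 < eta -> exists2 d, 0 < d <= 1 &
    forall u l, lam u <= d -> is_line l -> exists2 l', is_line l' &
      forall v, thicken l (eta * lam u) (phi (act (u ++ v) o)) ->
        thicken l' (L * (eta * lam u)) (act (u ++ v) o)].
Proof.
(* Contains every point within [M + 1] of an orbit point, hence all of the neighbourhoods with
   [delta <= 1]. *)
pose Bo := enorm o + M + (M + 1).
have bo w : enorm (act w o) <= enorm o + M.
  have -> : act w o = o + (act w o - o) by rewrite addrC subrK.
  by apply: le_trans (enormD _ _) _; rewrite lerD2l.
have bo' w x : enorm (x - act w o) <= M + 1 -> enorm x <= Bo.
  move=> h; have -> : x = act w o + (x - act w o) by rewrite addrC subrK.
  by apply: le_trans (enormD _ _) _; apply: lerD.
have boB w : enorm (act w o) <= Bo.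
  by apply: (bo' w); rewrite subrr enorm0 addr_ge0 // ltW.
have [L1 L10 h1] := C1_lipschitz phiC1 Bo.
pose B := enorm (phi o) + L1 * M + 1.
have bp w : enorm (phi (act w o)) <= enorm (phi o) + L1 * M.
  have -> : phi (act w o) = phi o + (phi (act w o) - phi o) by rewrite addrC subrK.
  apply: le_trans (enormD _ _) _; rewrite lerD2l.
  by apply: le_trans (h1 _ _ (boB [::]) (boB w)) _; rewrite ler_pM2l.
have bpB w : enorm (phi (act w o)) <= B by apply: le_trans (bp w) _; rewrite lerDl.
have [L2 L20 h2] := C1_lipschitz psiC1 B.
have [K K0 hK] := C1_diff_bound psiC1 B.
pose L := L1 + L2 + K + 1.
have B0 : 0 < B by rewrite ltr_wpDl // addr_ge0 ?enorm_ge0 // mulr_ge0 // ltW.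
exists L, B; split => //.
- by rewrite /L lerDr !addr_ge0 // ltW.
- split.
  + move=> w x hx; apply: le_trans (h1 _ _ (boB w) (bo' w x hx)) _.
    by rewrite ler_wpM2r ?enorm_ge0 // /L; lra.
  + move=> w y hy.
    have yB : enorm y <= B.
      have -> : y = phi (act w o) + (y - phi (act w o)) by rewrite addrC subrK.
      by apply: le_trans (enormD _ _) _; apply: lerD.
    have := h2 _ _ (bpB w) yB; rewrite phiK => /le_trans; apply.
    by rewrite ler_wpM2r ?enorm_ge0 // /L; lra.
  + move=> u v; have := h2 _ _ (bpB v) (bpB u); rewrite !phiK => /le_trans; apply.
    by rewrite ler_wpM2r ?enorm_ge0 // /L; lra.
  + exact: bpB.
move=> eta eta0; have LM0 : 0 < L1 * M by rewrite mulr_gt0.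
(* The image of the cylinder of [u] stays within [L1 * M * lam u] of [phi (act u o)], so this
   precision makes the linearisation error at most [eta * lam u]. *)
have [d d0 hd] := C1_expand psiC1 B (divr_gt0 eta0 LM0).
exists (Num.min 1 (d / (L1 * M))).
  by rewrite lt_min ltr01 divr_gt0 //= ge_min lexx.
move=> u l; rewrite le_min => /andP[_ ud] [p [v0 [v00 lE]]].
have [l' ll' hl'] := line_through (act u o + 'd psi (phi (act u o)) (p - phi (act u o)))
  ('d psi (phi (act u o)) v0).
exists l' => // v /thickenP[z]; rewrite lE => -[t _ tz] zy.
have lu0 := lam_gt0 T u.
set x := act (u ++ v) o in zy *.
set x0 := act u o in hl' *.
set y0 := phi x0 in hl' *.
have xx0 : enorm (phi x - y0) <= L1 * M * lam u.
  apply: le_trans (h1 _ _ (boB u) (boB (u ++ v))) _.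
  rewrite -mulrA ler_pM2l //; apply: le_trans (act_cat_near oM u v) _.
  by [].
have err := hd y0 (phi x) (bpB u) _.
rewrite ler_pdivlMr // mulrC in ud.
have {}err := err (le_trans xx0 ud).
rewrite !phiK in err.
apply/thickenP; exists (x0 + 'd psi y0 (z - y0)).
  have -> : x0 + 'd psi y0 (z - y0) = x0 + 'd psi y0 (p - y0) + t *: 'd psi y0 v0.
    by rewrite -linearZ -addrA -linearD; congr (_ + 'd _ _ _); rewrite -tz addrAC.
  exact: hl'.
have -> : x0 + 'd psi y0 (z - y0) - x =
   'd psi y0 (z - phi x) - (x - x0 - 'd psi y0 (phi x - y0)).
  have -> : 'd psi y0 (z - y0) = 'd psi y0 (z - phi x) + 'd psi y0 (phi x - y0).
    by rewrite -linearD; congr ('d _ _ _); rewrite addrA subrK.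
  move: ('d psi y0 (z - phi x)) ('d psi y0 (phi x - y0)) => a b.
  by apply: plane_ext; rewrite !planeE; ring.
apply: le_trans (enormD _ _) _; rewrite enormN.
have e1 : enorm ('d psi y0 (z - phi x)) <= K * (eta * lam u).
  by apply: le_trans (hK _ _ (bpB u)) _; rewrite ler_pM2l.
have e2 : enorm (x - x0 - 'd psi y0 (phi x - y0)) <= eta * lam u.
  apply: le_trans err _; apply: le_trans (ler_wpM2l _ xx0) _.
    by rewrite divr_ge0 // ltW.
  by rewrite mulrA divfK // gt_eqF.
apply: le_trans (lerD e1 e2) _.
have el0 : 0 <= eta * lam u by rewrite mulr_ge0 // ltW.
rewrite /L; have : 0 <= (L1 + L2) * (eta * lam u) by rewrite mulr_ge0 // addr_ge0 // ltW.
by lra.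
Qed.

End Distortion.

(** * Thickened point sets *)

Section ThickGeneric.
Variable R : realType.

Lemma le_scale_area (X Y : \bar R) (k a : R) : 0 <= k ->
  (X <= (k * a)%:E)%E -> (a%:E <= Y)%E -> (X <= k%:E * Y)%E.
Proof.
by move=> k0 h1 h2; apply: le_trans h1 _; rewrite EFinM lee_wpmul2l.
Qed.

Lemma card_le_seq (U : eqType) (A : set U) (F : seq U) :
  (forall x, A x -> x \in F) -> (A #<= `I_(size F))%card.
Proof.
case: F => [|x0 F] AF.
  have -> : A = set0 by apply/seteqP; split => // x /AF.
  exact: card_ge0.
apply: card_le_trans (card_image_le (nth x0 (x0 :: F)) `I_(size (x0 :: F))).
apply: subset_card_le => x /AF xF; exists (index x (x0 :: F)); last exact: nth_index.
by move: xF; rewrite -index_mem.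
Qed.

Lemma powR_split (a k : R) : 0 < a -> a `^ k * a `^ (1 - k) = a.
Proof.
move=> a0; rewrite -powRD; last by rewrite (gt_eqF a0) implybT.
by rewrite addrC subrK powRr1 // ltW.
Qed.

End ThickGeneric.

Section Thick.
Variables (R : realType) (s : nat) (T : 'I_s -> similitude R).
Variables (c D : R).
Hypotheses (c0 : 0 < c) (c1 : c < 1).
Hypothesis cP : forall i, c <= sim_ratio (T i) <= 1 - c.
Hypotheses (D01 : 0 < D <= 1) (hD : \sum_i sim_ratio (T i) `^ D = 1).
Variables (O : set (plane R)) (o : plane R) (e M : R).
Hypothesis TO : \bigcup_i (sim_apply (T i) @` O) `<=` O.
Hypothesis TOd : trivIset [set: 'I_s] (fun i => sim_apply (T i) @` O).
Hypothesis e0 : 0 < e.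
Hypothesis oO : disc o e `<=` O.
Hypothesis M0 : 0 < M.
Hypothesis oM : forall w, enorm (act T w o - o) <= M.
Variable J : set (plane R).
Hypothesis J0 : J !=set0.
Hypothesis J_line : ~ (exists l, is_line l /\ J `<=` l).
Hypothesis J_cover : forall r y, 0 < r -> J y ->
  exists2 u, u \in cut T c r & enorm (y - act T u o) <= M * r.

Local Notation cut := (cut T c).
Local Notation act := (act T).
Local Notation lam := (lam T).
Local Notation mass := (mass T c D).

(** The assumptions on [phi] are those clauses of [distortion] that concern the image points
    alone. *)
Variables (phi : plane R -> plane R) (L B : R).
Hypotheses (L1 : 1 <= L) (B0 : 0 < B).
Hypothesis phi_inj : forall u v,
  enorm (act u o - act v o) <= L * enorm (phi (act u o) - phi (act v o)).
Hypothesis phi_bound : forall w, enorm (phi (act w o)) <= B.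
Hypothesis phi_flat : forall eta, 0 < eta -> exists2 d, 0 < d <= 1 &
  forall u l, lam u <= d -> is_line l -> exists2 l', is_line l' &
    forall v, thicken l (eta * lam u) (phi (act (u ++ v) o)) ->
      thicken l' (L * (eta * lam u)) (act (u ++ v) o).

Let D0 : 0 < D. Proof. by case/andP: D01. Qed.
Let D1 : D <= 1. Proof. by case/andP: D01. Qed.
Let D00 : 0 <= D. Proof. exact: ltW. Qed.
Let L0 : 0 < L. Proof. exact: lt_le_trans L1. Qed.
Let cD0 : 0 < c `^ D. Proof. exact: powR_gt0. Qed.

Definition pt (w : seq 'I_s) : plane R := phi (act w o).
Definition centres r : set (plane R) := [set pt w | w in [set` cut r]].

Variable K : R.
Hypothesis K0 : 0 < K.

Definition thickening r := thicken (centres r) (K * r).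

Lemma thickeningE r : thickening r = discs pt (cut r) (K * r).
Proof.
apply/seteqP; split => x; first by move=> [_ [w wr <-] h]; exists w.
by move=> [w wr h]; exists (pt w) => //; exists w.
Qed.

Lemma bmeas_thickening r : bmeas (thickening r).
Proof. by rewrite thickeningE; exact: bmeas_discs. Qed.

Let cr r : 0 < r -> r <= 1 -> c * r <= 1.
Proof. by move=> r0 r1; rewrite mulr_ile1 // ltW. Qed.

Lemma pt_separated r : 0 < r -> r <= 1 ->
  {in cut r &, forall u v, u != v -> c * e / L * r < enorm (pt u - pt v)}.
Proof.
move=> r0 r1 u v ur vr uv.
have h := cut_separated c0 cP c1 TO TOd e0 oO r0 (cr r0 r1) ur vr uv.
rewrite mulrAC ltr_pdivrMr // [_ * L]mulrC; exact: lt_le_trans h (phi_inj u v).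
Qed.

(* The discs of radius min (K, c e / (2 L)) r around the centres are disjoint. *)
Definition low : R := Num.min K (c * e / L / 2) ^+ 2.

Lemma low_gt0 : 0 < low.
Proof. by rewrite exprn_gt0 // lt_min K0 !divr_gt0 // mulr_gt0. Qed.

Let split_r r : 0 < r -> r `^ (2 - D) = r ^+ 2 / r `^ D.
Proof.
by move=> r0; rewrite powRB ?(gt_eqF r0) ?implybT // -[2%:R]/(2%:R) powR_mulrn // ltW.
Qed.

Lemma area_thickening_ge r : 0 < r -> r <= 1 ->
  ((low * r `^ (2 - D))%:E <= area (thickening r))%E.
Proof.
move=> r0 r1; set k := Num.min K (c * e / L / 2).
have k0 : 0 < k by rewrite lt_min K0 !divr_gt0 // mulr_gt0.
have sub : discs pt (cut r) (k * r) `<=` thickening r.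
  rewrite thickeningE => x [w wr h]; exists w => //; apply: le_trans h _.
  by rewrite ler_pM2r // ge_min lexx.
apply: le_trans (area_le (bmeas_discs _ _ _) (bmeas_thickening r) sub).
apply: le_trans (area_discs_ge _ _ _).
- rewrite lee_fin split_r // /low -/k exprMn.
  have := size_cut_ge c0 c1 cP D00 hD r0 => hs.
  have rD : 0 < r `^ D by rewrite powR_gt0.
  rewrite mulrA ler_pdivrMr //.
  have -> : (size (cut r))%:R * (k ^+ 2 * r ^+ 2) * r `^ D =
    (size (cut r))%:R * r `^ D * (k ^+ 2 * r ^+ 2) by ring.
  by rewrite -[leLHS]mul1r ler_wpM2r // mulr_ge0 ?sqr_ge0.
- by rewrite mulr_ge0 // ltW.
- exact: (cut_uniq c0 cP c1).
- move=> u v ur vr uv; apply: le_lt_trans (pt_separated r0 r1 ur vr uv).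
  rewrite mulrA ler_pM2r // mulrC -ler_pdivlMr // ge_min lexx orbT //.
Qed.

(** Mass over the least weight (c r)^D bounds the number of discs meeting [E]. The area [m] per disc
    is a parameter because a thin [E] takes only a small part of a disc. *)
Lemma area_thickening_le r (Q : seq 'I_s -> Prop) E m : 0 < r -> r <= 1 -> bmeas E -> 0 <= m ->
  (forall w x, disc (pt w) (K * r) x -> E x -> Q w) ->
  (forall w, (area (disc (pt w) (K * r) `&` E) <= m%:E)%E) ->
  (area (thickening r `&` E) <= (mass r Q / (c * r) `^ D * m)%:E)%E.
Proof.
move=> r0 r1 mE m0 hQ hm.
have sub : thickening r `&` E `<=` discs pt [seq w <- cut r | `[< Q w >]] (K * r) `&` E.
  rewrite thickeningE => x [[w wr wx] Ex]; split => //; exists w => //=.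
  by rewrite mem_filter wr andbT; apply/asboolP; exact: hQ wx Ex.
apply: le_trans (area_le _ _ sub) _.
- by apply: bmeasI => //; exact: bmeas_thickening.
- by apply: bmeasI => //; exact: bmeas_discs.
apply: le_trans (area_discs_le mE m0 (fun i _ => hm i)) _.
rewrite lee_fin ler_wpM2r // ler_pdivlMr ?powR_gt0 ?mulr_gt0 //.
exact: (le_size_mass c0 c1 cP D00 _ r0 (cr r0 r1)).
Qed.

Let area_factor_ge0 : 0 <= 4 * K ^+ 2 / c `^ D.
Proof.
by apply: divr_ge0; [apply: mulr_ge0 => //; exact: sqr_ge0|exact: powR_ge0].
Qed.

Lemma area_thickening_mass r (Q : seq 'I_s -> Prop) E : 0 < r -> r <= 1 -> bmeas E ->
  (forall w x, disc (pt w) (K * r) x -> E x -> Q w) ->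
  (area (thickening r `&` E) <= (mass r Q * (4 * K ^+ 2 / c `^ D) * r `^ (2 - D))%:E)%E.
Proof.
move=> r0 r1 mE hQ; have Kr : 0 <= K * r by rewrite mulr_ge0 // ltW.
have m0 : 0 <= 4 * (K * r) ^+ 2 by rewrite mulr_ge0 ?sqr_ge0.
apply: le_trans (area_thickening_le r0 r1 mE m0 hQ _) _.
  move=> w; apply: (@area_sub_disc _ _ (pt w)) => //.
  by apply: bmeasI => //; exact: bmeas_disc.
rewrite lee_fin split_r // powRM ?(ltW c0) ?(ltW r0) //.
rewrite le_eqVlt; apply/orP; left; apply/eqP.
by field; rewrite (gt_eqF cD0) gt_eqF // powR_gt0.
Qed.

(** [x] need not be an image point: recentring at some [pt w0] in the ball doubles the radius, and
    pulling back by [phi_inj] multiplies it by [L]. *)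
Lemma mass_pt_ball : exists2 N : R, 0 < N & forall r t x, 0 < r -> r <= t ->
  mass r (fun w => enorm (pt w - x) <= t) <= N * t `^ D.
Proof.
have [N N0 hN] := mass_ball c0 c1 cP D00 hD TO TOd e0 oO M0 oM.
have L20 : 0 <= 2 * L by rewrite mulr_ge0 // ltW.
exists (N * (2 * L) `^ D); first by rewrite mulr_gt0 // powR_gt0 // mulr_gt0.
move=> r t x r0 rt; have t0 := lt_le_trans r0 rt.
have [[w0 hw0]|nw] := pselect (exists w, enorm (pt w - x) <= t); last first.
  rewrite mass_pred0; last by move=> w hw; apply: nw; exists w.
  by rewrite !mulr_ge0 ?powR_ge0 // ltW.
rewrite -mulrA -powRM ?(ltW t0) //.
have rt' : r <= 2 * L * t.
  by apply: le_trans rt _; rewrite ler_peMl ?(ltW t0) //; have := L1; lra.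
apply: le_trans (hN r (2 * L * t) (act w0 o) r0 rt').
apply: le_mass => w hw; apply: le_trans (phi_inj w w0) _.
rewrite [2 * L]mulrC -mulrA ler_pM2l //.
apply: le_trans (enorm_triangle x _ _) _; rewrite [enorm (x - _)]enormB.
by move: hw hw0; rewrite /pt; lra.
Qed.

Lemma disc_union_thickening : exists2 C0 : R, 0 < C0 & forall C r, C0 <= C ->
  0 < r -> r <= 1 -> disc_union C (K * r) (thickening r).
Proof.
exists (4 * (2 * K / (c * e / L) + 1) ^+ 2).
  by rewrite mulr_gt0 // exprn_gt0 // addr_gt0 // !divr_gt0 ?mulr_gt0.
move=> C r hC r0 r1; exists (centres r); split => //.
  have [y Jy] := J0; have [u ur _] := J_cover r0 Jy.
  by exists (pt u); exists u.
move=> x; pose F := [seq w <- cut r | enorm (pt w - x) <= K * r].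
exists (size (map pt F)); last first.
  apply: card_le_seq => y [[w wr <-]]; rewrite discE => h.
  by apply: map_f; rewrite mem_filter h.
rewrite size_map; apply: le_trans hC.
have -> : 2 * K / (c * e / L) = 2 * (K * r) / (c * e / L * r).
  by field; rewrite (gt_eqF r0) (gt_eqF L0) (gt_eqF c0) (gt_eqF e0).
apply: (@packing _ _ pt _ (c * e / L * r) (K * r) x).
- by rewrite mulr_gt0 // divr_gt0 // mulr_gt0.
- by rewrite mulr_ge0 // ltW.
- by rewrite filter_uniq // (cut_uniq c0 cP c1).
- by move=> u v; rewrite !mem_filter => /andP[_ ur] /andP[_ vr]; exact: pt_separated.
- by move=> w; rewrite mem_filter => /andP[].
Qed.

Lemma area_thickening_bounds : exists2 C0 : R, 0 < C0 & forall C r, C0 <= C ->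
  0 < r -> r <= 1 ->
  ((C^-1 * (K * r) `^ (2 - D))%:E <= area (thickening r))%E /\
  (area (thickening r) <= (C * (K * r) `^ (2 - D))%:E)%E.
Proof.
have KD : 0 < K `^ (2 - D) by rewrite powR_gt0.
have P1 : 0 < K `^ (2 - D) / low by rewrite divr_gt0 // low_gt0.
have P2 : 0 < 4 * K ^+ 2 / c `^ D / K `^ (2 - D).
  by rewrite !divr_gt0 // mulr_gt0 // exprn_gt0.
exists (K `^ (2 - D) / low + 4 * K ^+ 2 / c `^ D / K `^ (2 - D)); first by rewrite addr_gt0.
move=> C r hC r0 r1; have rD : 0 < r `^ (2 - D) by rewrite powR_gt0.
have C0 : 0 < C by apply: lt_le_trans hC; rewrite addr_gt0.
rewrite powRM ?(ltW K0) ?(ltW r0) //; split.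
  apply: le_trans (area_thickening_ge r0 r1); rewrite lee_fin mulrA ler_pM2r //.
  rewrite mulrC ler_pdivrMr // mulrC -ler_pdivrMr ?low_gt0 //.
  by apply: le_trans hC; rewrite lerDl ltW.
have := @area_thickening_mass r (fun=> True) setT r0 r1 measurableT (fun _ _ _ _ => I).
rewrite setIT => /le_trans; apply; rewrite lee_fin [C * _]mulrA ler_pM2r // -ler_pdivrMr //.
apply: le_trans hC; apply: le_trans (_ : 4 * K ^+ 2 / c `^ D / K `^ (2 - D) <= _); last first.
  by rewrite lerDr ltW.
rewrite ler_pM2r ?invr_gt0 // ler_piMl ?(mass_le1 c0 c1 cP hD) //.
Qed.

Lemma area_thickening_ball : exists2 C0 : R, 0 < C0 & forall C r x t, C0 <= C ->
  0 < r -> r <= 1 -> 0 < t ->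
  (area (thickening r `&` disc x t) <= (C * t `^ D)%:E * area (thickening r))%E.
Proof.
have [N N0 hN] := mass_pt_ball; have l0 := low_gt0.
have K1 : 0 < 1 + K by rewrite addr_gt0.
have K1D : 0 < (1 + K) `^ D by rewrite powR_gt0.
pose A := N * (1 + K) `^ D * (4 * K ^+ 2 / c `^ D).
have A0 : 0 < A by rewrite !mulr_gt0 ?invr_gt0 // exprn_gt0.
exists (A / low + 4 / low); first by rewrite addr_gt0 // divr_gt0.
move=> C r x t hC r0 r1 t0; have rD : 0 < r `^ (2 - D) by rewrite powR_gt0.
have tD : 0 < t `^ D by rewrite powR_gt0.
have hC1 : A <= C * low.
  by rewrite -ler_pdivrMr //; apply: le_trans hC; rewrite lerDl ltW // divr_gt0.
have hC2 : 4 <= C * low.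
  by rewrite -ler_pdivrMr //; apply: le_trans hC; rewrite lerDr ltW // divr_gt0.
have C0 : 0 <= C by apply: le_trans hC; rewrite addr_ge0 // ltW // divr_gt0.
apply: le_scale_area (area_thickening_ge r0 r1); first by rewrite mulr_ge0 // ltW.
have E : C * t `^ D * (low * r `^ (2 - D)) = C * low * (t `^ D * r `^ (2 - D)) by ring.
have [rt|tr] := leP r t.
  apply: le_trans (@area_thickening_mass r (fun w => enorm (pt w - x) <= (1 + K) * t)
    (disc x t) r0 r1 (bmeas_disc _ _) _) _.
    move=> w y; rewrite !discE => h1 h2; apply: le_trans (enorm_triangle y _ _) _.
    rewrite [enorm (y - x)]enormB.
    have : K * r <= K * t by rewrite ler_pM2l.
    by lra.
  rewrite lee_fin E [C * low * _]mulrA ler_pM2r //.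
  apply: le_trans (ler_wpM2r _ (hN r ((1 + K) * t) x r0 _)) _.
  - exact: area_factor_ge0.
  - by apply: le_trans rt _; rewrite ler_peMl ?(ltW t0) // lerDl ltW.
  rewrite powRM ?(ltW t0) ?(ltW K1) //.
  have -> : N * ((1 + K) `^ D * t `^ D) * (4 * K ^+ 2 / c `^ D) = A * t `^ D.
    by rewrite /A; ring.
  by rewrite ler_pM2r.
(* Below the level the area of the disc suffices: t^2 = t^D t^(2 - D) <= t^D r^(2 - D). *)
apply: le_trans (@area_sub_disc _ _ x t _ (ltW t0) _) _.
- by apply: bmeasI; [exact: bmeas_thickening|exact: bmeas_disc].
- by move=> y [].
rewrite lee_fin E.
have -> : t ^+ 2 = t `^ D * t `^ (2 - D).
  by rewrite split_r // mulrC divfK // gt_eqF.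
apply: ler_pM => //; first by rewrite mulr_ge0 ?powR_ge0.
rewrite ler_pM2l // ge0_ler_powR ?nnegrE ?(ltW t0) ?(ltW r0) ?(ltW tr) //.
by rewrite subr_ge0 (le_trans D1) // ler1n.
Qed.

(* For r <= rs the flatness of phi on cylinders of level d reduces the estimate to
   mass_curve; for r > rs the area of the strip itself is small enough. *)
Lemma area_thickening_line : exists2 C0 : R, 0 < C0 & forall C r l, C0 <= C ->
  0 < r -> r <= 1 -> is_line l ->
  (area (thickening r `&` thicken l C^-1) <= (10^-1)%:E * area (thickening r))%E.
Proof.
have [C1 [k [C10 /andP[k0 k1] hC1]]] :=
  mass_line c0 c1 cP D00 hD M0 oM J0 J_line J_cover.
have l0 := low_gt0.
have Q0 : 0 < C1 * (4 * K ^+ 2 / c `^ D) by rewrite !mulr_gt0 ?invr_gt0 // exprn_gt0.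
pose t0 := Num.min 1 ((low / 10 / (C1 * (4 * K ^+ 2 / c `^ D))) `^ k^-1).
have t00 : 0 < t0 by rewrite lt_min ltr01 powR_gt0 // !divr_gt0.
have t01 : t0 <= 1 by rewrite ge_min lexx.
have ht0 : C1 * t0 `^ k * (4 * K ^+ 2 / c `^ D) <= low / 10.
  rewrite mulrAC mulrC -ler_pdivlMr //.
  set q := low / 10 / _; have q0 : 0 < q by rewrite !divr_gt0.
  have -> : q = (q `^ k^-1) `^ k by rewrite -powRrM mulVf ?gt_eqF // powRr1 // ltW.
  by rewrite ge0_ler_powR ?nnegrE ?powR_ge0 ?(ltW k0) ?(ltW t00) // ge_min lexx orbT.
(* Pulling back multiplies widths by [L], so that the relative width becomes [t0], for which the
   mass bound gives the factor 1/10. *)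
pose eta := t0 / L; have eta0 : 0 < eta by rewrite divr_gt0.
have [d /andP[d0 d1] hd] := phi_flat eta0.
have ecd : 0 < eta * (c * d) := mulr_gt0 eta0 (mulr_gt0 c0 d0).
(* The first bound is required by [mass_curve]; the second lets the disc radius [K * r] use at most
   half of the admissible width [eta * (c * d)]. *)
pose rs := Num.min (t0 * (c * d)) (eta * (c * d) / (2 * K)).
have rs0 : 0 < rs by rewrite lt_min (mulr_gt0 t00 (mulr_gt0 c0 d0)) divr_gt0 // mulr_gt0.
have BK0 : 0 < B + K by rewrite addr_gt0.
have lrs : 0 < low * rs `^ (2 - D) by rewrite mulr_gt0 // powR_gt0.
have [m [m0 mE]] : exists m : R, 0 < m /\ m = 128 * 10.
  by exists (128 * 10); split => //; apply: mulr_gt0; rewrite ltr0n.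
(* [E1] leaves the other half of the width to [C^-1]. [E2] makes the whole strip, of area at most
   128 C^-1 (B + K), a tenth of the least area at level [rs]. The summand [(B + K)^-1] below ensures
   [C^-1 <= B + K], as [area_strip] requires. *)
pose E1 := 2 / (eta * (c * d)); pose E2 := m * (B + K) / (low * rs `^ (2 - D)).
have E10 : 0 < E1 by rewrite divr_gt0.
have E20 : 0 < E2 by rewrite divr_gt0 // mulr_gt0.
exists (E1 + E2 + (B + K)^-1); first by rewrite !addr_gt0 ?invr_gt0.
move=> C r l hC r0 r1 ll.
have C0 : 0 < C by apply: lt_le_trans hC; rewrite !addr_gt0 ?invr_gt0.
have BKi : 0 < (B + K)^-1 by rewrite invr_gt0.
have CE1 : C^-1 <= eta * (c * d) / 2.
  rewrite -[leRHS]invrK lef_pV2 ?posrE ?invr_gt0 ?divr_gt0 // invf_div -/E1.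
  by apply: le_trans hC; lra.
have CE2 : C^-1 <= low * rs `^ (2 - D) / (m * (B + K)).
  have h : 0 < low * rs `^ (2 - D) / (m * (B + K)) := divr_gt0 lrs (mulr_gt0 m0 BK0).
  rewrite -[leRHS]invrK lef_pV2 ?posrE ?invr_gt0 //.
  by rewrite invf_div -/E2; apply: le_trans hC; lra.
have CBK : C^-1 <= B + K.
  by rewrite -[leRHS]invrK lef_pV2 ?posrE //; apply: le_trans hC; lra.
have ci0 : 0 < C^-1 by rewrite invr_gt0.
have mS := bmeas_thicken_line C^-1 ll.
apply: (@le_scale_area _ _ _ 10^-1 _ _ _ (area_thickening_ge r0 r1)); first by rewrite invr_ge0.
have [rrs|rrs] := leP r rs.
  apply: le_trans (@area_thickening_mass r (fun w => thicken l (C^-1 + K * r) (pt w))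
    _ r0 r1 mS _) _.
    move=> w x; rewrite discE => h /thickenP[z lz zx]; apply/thickenP; exists z => //.
    apply: le_trans (enorm_triangle x _ _) _; apply: lerD => //.
    by rewrite enormB.
  rewrite lee_fin [10^-1 * _]mulrA ler_pM2r ?powR_gt0 // [10^-1 * _]mulrC.
  apply: le_trans ht0; apply: ler_wpM2r.
    exact: area_factor_ge0.
  apply: (mass_curve c0 c1 cP hD hC1 d0 d1 t00 t01 r0).
    by apply: le_trans rrs _; rewrite ge_min lexx.
  move=> u ud; have [l' ll' hl'] := hd u l (lam_cut_le c0 cP c1 d0 ud) ll.
  exists l' => // v hv.
  have -> : t0 * lam u = L * (eta * lam u).
    by rewrite /eta; field; rewrite gt_eqF.
  apply: hl'; move/thickenP: hv => [z lz zx]; apply/thickenP; exists z => //.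
  apply: le_trans zx _; apply: le_trans (_ : eta * (c * d) <= _); last first.
    by rewrite ler_pM2l //; apply: (lam_cut_ge c0 cP c1) => //; exact: cr.
  have h2 : K * r <= eta * (c * d) / 2.
    apply: le_trans (_ : K * rs <= _); first by rewrite ler_pM2l.
    have : rs <= eta * (c * d) / (2 * K) by rewrite ge_min lexx orbT.
    rewrite ler_pdivlMr ?mulr_gt0 //.
    by move: (eta * (c * d)) => X; lra.
  by move: CE1 h2; lra.
apply: le_trans (@area_strip _ l 0 C^-1 (B + K) _ ll ci0 CBK _ _) _.
- by apply: bmeasI => //; exact: bmeas_thickening.
- rewrite thickeningE => x [[w wr h] hx]; split => //; rewrite discE sub0r enormN.
  have -> : x = pt w + (x - pt w) by rewrite addrC subrK.
  apply: le_trans (enormD _ _) _; apply: lerD; first exact: phi_bound.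
  by rewrite enormB; apply: le_trans h _; rewrite ler_piMr // ltW.
rewrite lee_fin.
apply: le_trans (_ : 10^-1 * (low * rs `^ (2 - D)) <= _).
  apply: le_trans (_ : 128 * (low * rs `^ (2 - D) / (m * (B + K))) * (B + K) <= _).
    by rewrite ler_wpM2r ?(ltW BK0) // ler_wpM2l.
  by rewrite le_eqVlt; apply/orP; left; apply/eqP; rewrite mE; field; rewrite gt_eqF.
rewrite ler_wpM2l ?invr_ge0 // ler_pM2l // ge0_ler_powR ?nnegrE ?(ltW rs0) ?(ltW r0) ?(ltW rrs) //.
by rewrite subr_ge0 (le_trans D1) // ler1n.
Qed.

Lemma thickening_unconcentrated : exists2 C0 : R, 0 < C0 & forall C r, C0 <= C ->
  0 < r -> r <= 1 -> unconcentrated_set D C (K * r) (thickening r).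
Proof.
have [A1 A10 h1] := disc_union_thickening.
have [A2 A20 h2] := area_thickening_bounds.
have [A3 A30 h3] := area_thickening_ball.
have [A4 A40 h4] := area_thickening_line.
exists (A1 + A2 + A3 + A4); first by rewrite !addr_gt0.
move=> C r hC r0 r1.
have C1 : A1 <= C by apply: le_trans hC; lra.
have C2 : A2 <= C by apply: le_trans hC; lra.
have C3 : A3 <= C by apply: le_trans hC; lra.
have C4 : A4 <= C by apply: le_trans hC; lra.
split; [split => //|exact: h1|exact: h2| |].
- by rewrite mulr_gt0.
- exact: lt_le_trans A10 C1.
- by move=> x t; exact: h3.
- by move=> l; exact: h4.
Qed.

(* For r2 < r the area of Q suffices; otherwise count the discs which meet Q, each
   of them in area O(r^2) if r <= r1 and O(r1 r) if r1 < r. *)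
Lemma thickening_rectangle C1 k : (forall w, pt w = act w o) -> D = 1 ->
  0 < C1 -> 0 < k <= 2^-1 ->
  (forall l r t, is_line l -> 0 < r -> r <= t ->
    mass r (fun w => thicken l t (act w o)) <= C1 * t `^ k) ->
  exists2 C0 : R, 0 < C0 & forall C r r1 r2 Q, C0 <= C -> 0 < r -> r <= 1 ->
    0 < r1 -> r1 <= r2 -> is_rectangle r1 r2 Q ->
    (area (thickening r `&` Q) <=
      (C * r1 `^ k * r2 `^ (1 - k))%:E * area (thickening r))%E.
Proof.
move=> ptE DE C10 /andP[k0 k2] hC1; have l0 := low_gt0.
have k1 : k <= 1 by apply: le_trans k2 _; rewrite invf_le1 // ler1n.
have kD : k <= D by rewrite DE.
have [C' C'0 hC'] := mass_line_ball c0 c1 cP D00 TO TOd e0 oO M0 oM C10 k0 hC1 kD.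
have K1 : 0 < 1 + K by rewrite addr_gt0.
have K2 : 0 < 2 + K by rewrite addr_gt0.
pose A := C' * (1 + K) `^ k * (2 + K) `^ (1 - k).
have A0 : 0 < A by rewrite !mulr_gt0 // powR_gt0.
have KC0 : 0 < 4 * K ^+ 2 / c by rewrite divr_gt0 // mulr_gt0 // exprn_gt0.
have [m m0 mE] : exists2 m : R, 0 < m & m = 128 by exists 128; rewrite ?ltr0n.
have mK0 : 0 < m * (1 + K) / c by rewrite divr_gt0 // mulr_gt0.
have [E1 E10 E1E] : exists2 E1 : R, 0 < E1 & E1 = A * (4 * K ^+ 2 / c).
  by exists (A * (4 * K ^+ 2 / c)) => //; rewrite mulr_gt0.
have [E2 E20 E2E] : exists2 E2 : R, 0 < E2 & E2 = A * (m * (1 + K) / c).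
  by exists (A * (m * (1 + K) / c)) => //; rewrite mulr_gt0.
exists ((E1 + E2 + m) / low); first by rewrite divr_gt0 // !addr_gt0.
move=> C r r1 r2 Q hC r0 rr1 r10 r12 hQ.
have r20 := lt_le_trans r10 r12.
have {}hC : E1 + E2 + m <= C * low by rewrite -ler_pdivrMr.
have CE1 : E1 <= C * low by lra.
have CE2 : E2 <= C * low by lra.
have CE3 : m <= C * low by lra.
have C0 : 0 <= C by rewrite -(pmulr_lge0 _ l0); apply: le_trans CE3; exact: ltW.
have pr1 : 0 < r1 `^ k by rewrite powR_gt0.
have pr2 : 0 < r2 `^ (1 - k) by rewrite powR_gt0.
have mQ := bmeas_rectangle hQ.
apply: le_scale_area (area_thickening_ge r0 rr1); first by rewrite !mulr_ge0 ?powR_ge0.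
have r2D : r `^ (2 - D) = r by rewrite DE -[2 - 1](_ : 1 = _) ?powRr1 ?(ltW r0) //; lra.
rewrite r2D.
have E : C * r1 `^ k * r2 `^ (1 - k) * (low * r) =
    C * low * (r1 `^ k * r2 `^ (1 - k) * r) by ring.
rewrite E.
have P0 : 0 < r1 `^ k * r2 `^ (1 - k) * r by rewrite !mulr_gt0.
have [r2r|rr2] := ltP r2 r.
  apply: le_trans (area_sub_rectangle r10 r12 hQ _ _) _.
  - by apply: bmeasI => //; exact: bmeas_thickening.
  - by move=> x [].
  have r1E := esym (powR_split k r10).
  have r1k : r1 `^ (1 - k) <= r2 `^ (1 - k).
    by rewrite ge0_ler_powR ?nnegrE ?subr_ge0 // ltW.
  have r12_0 : 0 <= r1 * r2 by rewrite mulr_ge0 // ltW.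
  have le_m : 32 * (r1 * r2) <= m * (r1 * r2).
    by apply: ler_wpM2r => //; rewrite mE ler_nat.
  rewrite lee_fin -mulrA; apply: le_trans le_m _.
  apply: le_trans (ler_wpM2r r12_0 CE3) _.
  have CL0 : 0 <= C * low by apply: le_trans CE3; exact: ltW.
  apply: ler_wpM2l CL0 _ _ _; rewrite {1}r1E; apply: ler_pM (ltW r2r).
  - by rewrite mulr_ge0 // powR_ge0.
  - exact: ltW.
  by rewrite ler_pM2l.
have [l [x [ll Ql Qx]]] := rectangle_sub_strip r10 r12 hQ.
(* A centre whose disc meets [Q] is within [r1 + K * r] of the line and, as [r <= r2], within
   [(2 + K) * r2] of [x]; the maximum ensures [r <= t]. *)
pose t := (1 + K) * Num.max r r1; pose q := (2 + K) * r2.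
have mx0 : 0 < Num.max r r1 by rewrite lt_max r0.
have rt : r <= t.
  by apply: le_trans (_ : Num.max r r1 <= _); [rewrite le_max lexx|rewrite ler_peMl ?(ltW mx0) // lerDl ltW].
have tq : t <= q.
  by apply: ler_pM; rewrite ?ge_max ?rr2 ?r12 ?(ltW K1) ?(ltW mx0) // lerD2r ler1n.
pose P w := thicken l t (act w o) /\ enorm (act w o - x) <= q.
have hP w y : disc (pt w) (K * r) y -> Q y -> P w.
  rewrite ptE discE => h Qy; split.
    have [z lz zy] := Ql _ Qy; exists z => //.
    rewrite discE in zy *; apply: le_trans (enorm_triangle y _ _) _.
    rewrite [enorm (y - _)]enormB /t mulrDl mul1r; apply: lerD.
      by apply: le_trans zy _; rewrite le_max lexx orbT.
    by apply: le_trans h _; rewrite ler_pM2l // le_max lexx.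
  have := Qx _ Qy; rewrite discE enormB => hx.
  apply: le_trans (enorm_triangle y _ _) _.
  rewrite /q mulrDl addrC; apply: lerD => //.
  by apply: le_trans h _; rewrite ler_pM2l.
have hm : mass r P <= A * (Num.max r r1 `^ k * r2 `^ (1 - k)).
  apply: le_trans (hC' l x r t q ll r0 rt tq) _.
  rewrite DE /t /q !powRM ?(ltW K1) ?(ltW K2) ?(ltW mx0) ?(ltW r20) //.
  by rewrite le_eqVlt; apply/orP; left; apply/eqP; rewrite /A; ring.
have [rr|rr] := leP r r1.
  rewrite (max_r rr) in hm.
  apply: le_trans (area_thickening_mass r0 rr1 mQ hP) _.
  rewrite lee_fin r2D [C * low * _]mulrA ler_pM2r //.
  apply: le_trans (ler_wpM2r area_factor_ge0 hm) _.
  rewrite DE powRr1 ?(ltW c0) //.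
  have -> : A * (r1 `^ k * r2 `^ (1 - k)) * (4 * K ^+ 2 / c) =
    E1 * (r1 `^ k * r2 `^ (1 - k)) by rewrite E1E; ring.
  by rewrite ler_pM2r // mulr_gt0.
rewrite (max_l (ltW rr)) in hm.
have r1K : r1 <= (1 + K) * r.
  by apply: le_trans (ltW rr) _; rewrite ler_peMl ?(ltW r0) // lerDl ltW.
have mr0 : 0 <= m * r1 * ((1 + K) * r) by rewrite !mulr_ge0 // ltW.
apply: le_trans (area_thickening_le r0 rr1 mQ mr0 hP _) _.
  move=> w; rewrite mE.
  apply: (@area_strip _ l (pt w) _ _ _ ll r10 r1K).
    by apply: bmeasI => //; exact: bmeas_disc.
  move=> y [wy /Ql Qy]; split => //.
  by apply: le_trans wy _; rewrite ler_pM2r // lerDr.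
have crD : (c * r) `^ D = c * r by rewrite DE powRr1 // mulr_ge0 // ltW.
rewrite lee_fin crD.
apply: le_trans (_ : A * (r `^ k * r2 `^ (1 - k)) / (c * r) * (m * r1 * ((1 + K) * r)) <= _).
  apply: ler_wpM2r mr0 _ _ _; apply: ler_wpM2r hm.
  by rewrite invr_ge0 mulr_ge0 // ltW.
have -> : A * (r `^ k * r2 `^ (1 - k)) / (c * r) * (m * r1 * ((1 + K) * r)) =
   E2 * (r1 * r `^ k * r2 `^ (1 - k)).
  by rewrite E2E; field; rewrite (gt_eqF c0) (gt_eqF r0).
have X0 : 0 <= r1 * r `^ k * r2 `^ (1 - k).
  by apply: mulr_ge0; [apply: mulr_ge0; [exact: ltW|exact: powR_ge0]|exact: ltW].
apply: ler_pM => //; first exact: ltW.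
(* What remains is r1 r^k <= r1^k r, that is r1^(1 - k) <= r^(1 - k). *)
rewrite [leRHS]mulrAC ler_pM2r //.
rewrite -{1}(powR_split k r10) -[X in _ <= _ * X](powR_split k r0).
rewrite [r `^ k * _]mulrC mulrA ler_pM2r ?powR_gt0 // ler_pM2l //.
by rewrite ge0_ler_powR ?nnegrE ?subr_ge0 // ltW.
Qed.

End Thick.

(** * From point sets to neighbourhoods *)

Section Equivalence.
Variables (R : realType) (s : nat) (T : 'I_s -> similitude R).
Variables (c M L : R) (o : plane R) (J : set (plane R)) (phi psi : plane R -> plane R).
Hypotheses (M0 : 0 < M) (L1 : 1 <= L) (psiK : cancel psi phi).
Hypothesis J_cover : forall r y, 0 < r -> J y ->
  exists2 u, u \in cut T c r & enorm (y - act T u o) <= M * r.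
Hypothesis J_near : forall r u, 0 < r -> u \in cut T c r ->
  exists2 y, J y & enorm (y - act T u o) <= M * r.
Hypothesis phi_lip : forall w x, enorm (x - act T w o) <= M + 1 ->
  enorm (phi x - phi (act T w o)) <= L * enorm (x - act T w o).
Hypothesis psi_lip : forall w y, enorm (y - phi (act T w o)) <= 1 ->
  enorm (psi y - act T w o) <= L * enorm (y - phi (act T w o)).

Lemma thicken_equivalent (P : R -> R -> set (plane R) -> Prop) :
  (forall K, 0 < K -> exists2 C0, 0 < C0 & forall C r, C0 <= C -> 0 < r -> r <= 1 ->
     P C (K * r) (thickening T c o phi K r)) ->
  exists C0 K0, [/\ 0 < C0, 0 < K0 & forall delta, 0 < delta <= 1 ->
    equivalent_to P K0 C0 delta (phi @` thicken J delta)].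
Proof.
(* A point of the neighbourhood is within M r + delta = (2 M + L) r of an orbit point, and [phi]
   multiplies this by at most [L]. *)
move=> hP; pose K2 := L * (2 * M + L).
have L0 : 0 < L by apply: lt_le_trans L1.
have ML0 : 0 < M + L by rewrite addr_gt0.
have ML1 : 1 <= M + L by apply: le_trans L1 _; rewrite lerDr ltW.
have K20 : 0 < K2 by rewrite mulr_gt0 // addr_gt0 // mulr_gt0.
have K2ML : M + L <= K2.
  apply: (@le_trans _ _ (2 * M + L)); first by have := M0; lra.
  by rewrite ler_peMl // addr_ge0 ?mulr_ge0 // ltW.
have [C1 C10 h1] := hP 1 ltr01.
have [C2 C20 h2] := hP K2 K20.
exists (C1 + C2), (M + L + K2); split; rewrite ?addr_gt0 // => delta /andP[d0 d1].
(* The disc of radius [r] around an image point pulls back into radius [L * r], and J is within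
   another [M * r]: together exactly [delta]. *)
pose r := delta / (M + L); have r0 : 0 < r by rewrite divr_gt0.
have rd : (M + L) * r = delta by rewrite mulrC divfK // gt_eqF.
have r1 : r <= 1 by rewrite ler_pdivrMr // mul1r; exact: le_trans ML1.
have C1C : C1 <= C1 + C2 by rewrite lerDl ltW.
have C2C : C2 <= C1 + C2 by rewrite lerDr ltW.
have K1 : 1 <= M + L + K2 by rewrite (le_trans ML1) // lerDl ltW.
have K0 : 0 < M + L + K2 by rewrite addr_gt0.
exists (C1 + C2), (C1 + C2), (1 * r), (K2 * r), (thickening T c o phi 1 r),
  (thickening T c o phi K2 r).
have self (a : R) : 0 < a -> comparable_up_to (M + L + K2) a a.
  move=> a0; rewrite /comparable_up_to; apply/andP; split.
    by rewrite ler_piMl ?(ltW a0) // invf_le1.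
  by rewrite ler_peMl ?(ltW a0).
split.
- by split; apply: self; rewrite addr_gt0.
- rewrite /comparable_up_to -{1 2 3 4}rd; split; apply/andP; split.
  + rewrite mulrA ler_pM2r // mulrC ler_pdivrMr // mul1r lerDl; exact: ltW.
  + rewrite mulrA ler_pM2r //; apply: le_trans ML1 _; rewrite ler_peMl ?(ltW ML0) //.
  + rewrite mulrA ler_pM2r //; apply: le_trans K2ML; rewrite ler_piMl ?(ltW ML0) // invf_le1 //.
  + rewrite mulrA ler_pM2r //; apply: (@le_trans _ _ (M + L + K2)).
      by rewrite lerDr ltW.
    by rewrite ler_peMr // ltW.
- exact: h1.
- exact: h2.
split.
  move=> y [_ [w wr <-]]; rewrite mul1r discE /pt enormB => hy.
  exists (psi y); last exact: psiK.
  have [z Jz zw] := J_near r0 wr.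
  apply/thickenP; exists z => //.
  apply: le_trans (enorm_triangle (act T w o) _ _) _.
  rewrite -rd mulrDl [enorm (_ - psi y)]enormB; apply: lerD => //.
  apply: le_trans (psi_lip (le_trans hy r1)) _.
  by rewrite ler_pM2l.
move=> _ [x /thickenP[y Jy yx] <-].
have [w wr yw] := J_cover r0 Jy.
exists (pt T o phi w); first by exists w.
rewrite discE enormB.
have xw : enorm (x - act T w o) <= M * r + delta.
  apply: le_trans (enorm_triangle y _ _) _; rewrite [enorm (x - y)]enormB.
  by rewrite addrC; apply: lerD.
apply: le_trans (phi_lip _) _.
  by apply: le_trans xw _; apply: lerD => //; rewrite ler_piMr // ltW.
rewrite /K2 -mulrA ler_pM2l //; apply: le_trans xw _.
by rewrite -rd le_eqVlt; apply/orP; left; apply/eqP; ring.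
Qed.

End Equivalence.

(** * Similarity dimension and coding of the attractor *)

Section Existence.
Variables (R : realType) (s : nat) (T : 'I_s -> similitude R).

Lemma ratio_bound_ex : exists c : R, [/\ 0 < c, c < 1 &
  forall i, c <= sim_ratio (T i) <= 1 - c].
Proof.
exists (\big[Num.min/2^-1]_i Num.min (sim_ratio (T i)) (1 - sim_ratio (T i))).
split.
- apply: lt_bigmin; first by rewrite invr_gt0.
  by move=> i _; rewrite lt_min sim_ratio_gt0 subr_gt0 sim_ratio_lt1.
- apply: (@le_lt_trans _ _ 2^-1); first exact: bigmin_le_id.
  by rewrite invf_lt1 // ltr1n.
move=> i; have := bigmin_le 2^-1 i (fun i => Num.min (sim_ratio (T i)) (1 - sim_ratio (T i))).
by rewrite le_min => /andP[-> h] /=; rewrite lerBrDr addrC -lerBrDr.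
Qed.

(** Intermediate value theorem: the sum is s >= 1 at exponent 0 and at most s (1 - c)^n <= 1 at a
    large integer n. A single map gives D = 0; positivity comes later from D = alpha. *)
Lemma similarity_dim_ex c : (0 < s)%N -> 0 < c -> c < 1 ->
  (forall i, c <= sim_ratio (T i) <= 1 - c) ->
  exists2 D : R, 0 <= D & \sum_i sim_ratio (T i) `^ D = 1.
Proof.
move=> s0 c0 c1 cP.
pose g (x : R) := \sum_i sim_ratio (T i) `^ x.
have s0R : 0 < s%:R :> R by rewrite ltr0n.
have [||n hn] := @expr_le_ex R (1 - c) s%:R^-1.
- by rewrite subr_ge0 (ltW c1) gtrBl.
- by rewrite invr_gt0.
have gn : g n%:R <= 1.
  apply: (@le_trans _ _ (\sum_(i < s) (1 - c) ^+ n)).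
    apply: ler_sum => i _; rewrite powR_mulrn ?(ltW (sim_ratio_gt0 _)) //.
    rewrite lerXn2r ?nnegrE ?(ltW (sim_ratio_gt0 _)) ?subr_ge0 ?(ltW c1) //.
    by case/andP: (cP i).
  by rewrite big_const_ord iter_addr_0 -[leLHS]mulr_natl mulrC -ler_pdivlMr // div1r.
have g0 : 1 <= g 0.
  rewrite /g (eq_bigr (fun=> 1)); last by move=> i _; rewrite powRr0.
  by rewrite big_const_ord iter_addr_0 ler1n.
have gc : continuous g.
  apply: (@continuous_big _ _ +%R 0 xpredT) => [x|i _ x]; first exact: add_continuous.
  rewrite /powR gt_eqF ?sim_ratio_gt0 //.
  apply: continuous_comp; last exact: continuous_expR.
  by apply: continuousM; [exact: cvg_id|exact: cvg_cst].
have [||D] := @IVT R g 0 n%:R 1 (ler0n _ _).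
- exact: continuous_subspaceT.
- by rewrite ge_min gn orbT le_max g0.
by rewrite in_itv /= => /andP[D0 _] gD; exists D.
Qed.

Variable J : set (plane R).
Hypothesis JE : J = \bigcup_i (sim_apply (T i) @` J).

Lemma attractor_act w y : J y -> J (act T w y).
Proof.
elim: w => [//|i w IH] /IH Jw; rewrite JE; exists i => //.
by exists (act T w y).
Qed.

Lemma attractor_cut c r y : 0 < c -> c < 1 ->
  (forall i, c <= sim_ratio (T i) <= 1 - c) -> 0 < r -> J y ->
  exists u z, [/\ u \in cut T c r, J z & act T u z = y].
Proof.
move=> c0 c1 cP r0; move: r r0 y; apply: (cut_ind c0 cP c1) => [r r1 y Jy|r h IH y].
  by exists [::], y; rewrite cut_ge1.
rewrite {1}JE => -[i _ [y' Jy' <-]].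
have [u [z [ur Jz <-]]] := IH i y' Jy'.
exists (i :: u), z; split => //; rewrite (cutS c0 cP c1) //.
by apply/allpairsPdep; exists i, u; rewrite mem_enum.
Qed.

End Existence.

Section PlaneTopology.
Variable R : realType.

Lemma compact_edisc (J : set (plane R)) (o : plane R) : compact J ->
  exists2 M, 0 < M & forall y, J y -> enorm (o - y) <= M.
Proof.
move=> cJ.
have [|F _ hF] := @compact_plane_cover R J _ (fun n : nat => [set y | enorm (y - o) < n%:R])
  cJ (fun n => @open_edisc R o n%:R).
  move=> y _; exists (Num.truncn (enorm (y - o))).+1 => //=.
  by have /andP[] := truncn_itv (enorm_ge0 (y - o)).
exists (1 + \sum_(i <- F) i%:R); first by rewrite ltr_pwDl // sumr_ge0.
move=> y /hF[n nF /= h]; rewrite enormB; apply: le_trans (ltW h) _.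
by rewrite (big_rem n nF) /= addrCA lerDl addr_ge0 // sumr_ge0.
Qed.

Lemma open_sub_disc (O : set (plane R)) (o : plane R) : open O -> O o ->
  exists2 e, 0 < e & disc o e `<=` O.
Proof.
rewrite openE => oO /oO /nbhs_ballP [e /= e0 he].
exists (e / 2); first by rewrite divr_gt0.
move=> y; rewrite discE => oy; apply: he; split; rewrite /ball /=.
  have := le_trans (norm1_le_enorm _) oy; rewrite !planeE => h.
  by apply: le_lt_trans h _; rewrite ltr_pdivrMr // ltr_pMr // ltr1n.
have := le_trans (norm2_le_enorm _) oy; rewrite !planeE => h.
by apply: le_lt_trans h _; rewrite ltr_pdivrMr // ltr_pMr // ltr1n.
Qed.

Lemma C1_map_id : C1_map (id : plane R -> plane R).
Proof.
have id_diff (x : plane R) : is_diff x (id : plane R -> plane R) id := is_diff_id x.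
split=> [x|v]; first by have [] := id_diff x.
have -> : (fun x : plane R => 'd (id : plane R -> plane R) x v) = (fun=> v).
  by apply/funext => x; have [_ ->] := id_diff x.
exact: cst_continuous.
Qed.

End PlaneTopology.

Theorem theorem5p1 (R : realType) (alpha : R) (J : set (plane R))
  (halpha : 0 < alpha <= 1)
  (hJ : self_similar_OSC J)
  (hdim : hausdorff_dim J = alpha%:E)
  (hline : ~ exists l : set (plane R), is_line l /\ J `<=` l) :
  [/\ alpha = 1 ->
        exists C0 kappa K : R, [/\ 0 < C0, 0 < kappa, 0 < K &
          forall delta : R, 0 < delta <= 1 ->
            equivalent_to (unrectifiable_one_set kappa) K C0 delta
              (thicken J delta)],
      alpha < 1 ->
        exists C0 K : R, [/\ 0 < C0, 0 < K &
          forall delta : R, 0 < delta <= 1 ->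
            equivalent_to (unconcentrated_set alpha) K C0 delta
              (thicken J delta)] &
      alpha < 1 ->
        forall phi : plane R -> plane R, diffeomorphism phi ->
        exists C0 K : R, [/\ 0 < C0, 0 < K &
          forall delta : R, 0 < delta <= 1 ->
            equivalent_to (unconcentrated_set alpha) K C0 delta
              (phi @` thicken J delta)]].
Proof.
have [s [T [[J0 cJ JE] [U [U0 openU TU TUd]]]]] := hJ.
have [c [c0 c1 cP]] := ratio_bound_ex T.
have [y0 Jy0] := J0.
have s0 : (0 < s)%N.
  have : J y0 by [].
  rewrite JE => -[i _ _].
  by case: s i {T JE TU TUd cP} => [[]|].
have [D D0 hD] := similarity_dim_ex s0 c0 c1 cP.
have [p Up] := U0.
have [e e0 oU] := open_sub_disc openU Up.
have [M1 M10 oJ1] := compact_edisc p cJ.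
(* One [M1] leads from [act w p] to [act w y0] in J, the other from there to [p]. *)
pose M := 2 * M1; have M0 : 0 < M by rewrite mulr_gt0.
have M1M : M1 <= M by rewrite /M; lra.
have oM w : enorm (act T w p - p) <= M.
  apply: le_trans (enorm_triangle (act T w y0) _ _) _; rewrite /M mulrDl mul1r.
  apply: lerD; last by rewrite enormB; apply: oJ1; exact: (attractor_act JE).
  rewrite act_dist; apply: le_trans (oJ1 _ Jy0).
  by rewrite ler_piMl ?enorm_ge0 // lam_le1.
have J_near r u : 0 < r -> u \in cut T c r ->
    exists2 y, J y & enorm (y - act T u p) <= M * r.
  move=> r0 ur; exists (act T u y0); first exact: (attractor_act JE).
  rewrite act_dist enormB mulrC; apply: ler_pM (le_trans (oJ1 _ Jy0) M1M) _.
  - exact: enorm_ge0.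
  - exact: ltW (lam_gt0 _ _).
  - exact: (lam_cut_le c0 cP c1).
have J_cover r y : 0 < r -> J y ->
    exists2 u, u \in cut T c r & enorm (y - act T u p) <= M * r.
  move=> r0 Jy; have [u [z [ur Jz <-]]] := attractor_cut JE c0 c1 cP r0 Jy.
  exists u => //; rewrite act_dist enormB mulrC; apply: ler_pM (le_trans (oJ1 _ Jz) M1M) _.
  - exact: enorm_ge0.
  - exact: ltW (lam_gt0 _ _).
  - exact: (lam_cut_le c0 cP c1).
have aD : alpha = D.
  have := hausdorff_dimE c0 c1 cP D0 hD TU TUd e0 oU M0 oM J0 J_cover cJ
    (attractor_act JE) (fun y Jy => le_trans (oJ1 y Jy) M1M).
  by rewrite hdim => -[].
rewrite -aD in D0 hD; clear aD D.
have unconc phi psi : cancel phi psi -> cancel psi phi -> C1_map phi -> C1_map psi ->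
    exists C0 K, [/\ 0 < C0, 0 < K & forall delta, 0 < delta <= 1 ->
    equivalent_to (unconcentrated_set alpha) K C0 delta (phi @` thicken J delta)].
  move=> phiK psiK hphi hpsi.
  have [L [B [L1 B0 [h1 h2 h3 h4] h5]]] := distortion M0 oM phiK hphi hpsi.
  apply: (thicken_equivalent M0 L1 psiK J_cover J_near h1 h2) => K K0.
  exact: (thickening_unconcentrated c0 c1 cP halpha hD TU TUd e0 oU M0 oM J0 hline
    J_cover L1 B0 h3 h4 h5 K0).
have idE A : A = (id : plane R -> plane R) @` A by rewrite image_id.
split.
- move=> a1.
  have [C1 [k [C10 k0 hC1]]] := mass_line c0 c1 cP D0 hD M0 oM J0 hline J_cover.
  have [L [B [L1 B0 [h1 h2 h3 h4] h5]]] := distortion M0 oM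
    (phi := id) (psi := id) (fun=> erefl) (@C1_map_id R) (@C1_map_id R).
  have hP K : 0 < K -> exists2 C0, 0 < C0 & forall C r, C0 <= C -> 0 < r -> r <= 1 ->
      unrectifiable_one_set k C (K * r) (thickening T c p id K r).
    move=> K0.
    have [A1 A10 hA1] := thickening_unconcentrated (phi := id) c0 c1 cP halpha hD TU TUd e0 oU M0 oM J0
      hline J_cover L1 B0 h3 h4 h5 K0.
    have [A2 A20 hA2] := thickening_rectangle (phi := id) c0 c1 cP halpha hD TU TUd e0 oU M0 oM L1 h3 K0
      (fun=> erefl) a1 C10 k0 hC1.
    exists (A1 + A2); first by rewrite addr_gt0.
    move=> C r hC r0 r1; split => //.
      by rewrite -a1; apply: hA1 => //; apply: le_trans hC; rewrite lerDl ltW.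
    move=> r1' r2 Q h0 h12 hQ; apply: hA2 => //; apply: le_trans hC.
    by rewrite lerDr ltW.
  have [C0 [K0 [C00 K00 hC0]]] := thicken_equivalent M0 L1 (phi := id) (psi := id)
    (fun=> erefl) J_cover J_near h1 h2 hP.
  exists C0, k, K0; split => //; first by case/andP: k0.
  by move=> delta hd; rewrite [thicken J delta]idE; exact: hC0.
- move=> _; have [C0 [K [C00 K0 h]]] := unconc id id (fun=> erefl) (fun=> erefl)
    (@C1_map_id R) (@C1_map_id R).
  exists C0, K; split => // delta hd; rewrite [thicken J delta]idE; exact: h.
by move=> _ phi [psi [phiK psiK hphi hpsi]]; exact: (unconc phi psi).
Qed.
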